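(* Let $B$ be a bialgebra in $\mathcal C$. The following statements are equivalent. 1. $B$ is isomorphic, as a bialgebra, to a cocycle cross product bialgebra on a tensor product $B_1\otimes B_2$. 2. There are idempotents $\Pi_1,\Pi_2\in\mathrm{End}(B)$ such that $$\mathrm m_B(\Pi_1\otimes\Pi_1)=\Pi_1\mathrm m_B(\Pi_1\otimes\Pi_1),\quad \Pi_1\eta_B=\eta_B,\quad (\Pi_2\otimes\Pi_2)\Delta_B=(\Pi_2\otimes\Pi_2)\Delta_B\Pi_2,\quad \varepsilon_B\Pi_2=\varepsilon_B,$$ the sequence $B\otimes B\xrightarrow{\mathrm m_B(\Pi_1\otimes\Pi_2)}B\xrightarrow{(\Pi_1\otimes\Pi_2)\Delta_B}B\otimes B$ is a splitting of the idempotent $\Pi_1\otimes\Pi_2$, and the following ''projection'' relations hold: $$(\gamma_1):\quad(\mathrm{id}\otimes\Pi_1)\circ\Delta_B=\delta_{(1,2,1)}\circ\gamma_1\circ(\Pi_1\otimes\Pi_2)\circ\Delta_B,$$ $$(\gamma_2):\quad\mathrm m_B\circ(\Pi_2\otimes\mathrm{id})=\mathrm m_B\circ(\Pi_1\otimes\Pi_2)\circ\gamma_2\circ\delta_{(2,1,2)},$$ $$(\delta_j):\quad(\Pi_j\otimes\mathrm{id})\circ\delta_{(0,0,0)}\circ(\mathrm{id}\otimes\Pi_j)=(\Pi_j\otimes\mathrm{id})\circ\delta_{(0,j,0)}\circ(\mathrm{id}\otimes\Pi_j)\quad\text{for }j\in\{1,2\},$$ where, with $\Pi_0=\mathrm{id}_B$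 and $i,j,k\in\{0,1,2\}$, $$\gamma_j=(\mathrm m_B\otimes\mathrm m_B)\circ(\mathrm{id}\otimes\Pi_j\otimes\mathrm{id}\otimes\mathrm{id})\circ(\mathrm{id}\otimes\Psi_{B,B}\otimes\mathrm{id})\circ(\Delta_B\otimes\Delta_B),$$ $$\delta_{(i,j,k)}=(\mathrm m_B\otimes\mathrm{id})\circ(\Pi_i\otimes\Pi_j\otimes\Pi_k)\circ(\mathrm{id}\otimes\Delta_B).$$ 3. There are objects $B_1$ (an algebra) and $B_2$ (a coalgebra) and morphisms $B_1\xrightarrow{\mathrm i_1}B\xrightarrow{\mathrm p_1}B_1$ and $B_2\xrightarrow{\mathrm i_2}B\xrightarrow{\mathrm p_2}B_2$, where $\mathrm i_1$ is an algebra morphism, $\mathrm p_2$ is a coalgebra morphism and $\mathrm p_j\circ\mathrm i_j=\mathrm{id}_{B_j}$ for $j\in\{1,2\}$, such that $\mathrm m_B\circ(\mathrm i_1\otimes\mathrm i_2):B_1\otimes B_2\to B$ and $(\mathrm p_1\otimes\mathrm p_2)\circ\Delta_B:B\to B_1\otimes B_2$ are mutually inverse isomorphisms, and the relations $(\gamma_1),(\gamma_2),(\delta_1),(\delta_2)$ hold with $\Pi_j:=\mathrm i_j\circ\mathrm p_j$, $j\in\{1,2\}$.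
   Context: $\mathcal C$ is a strict braided monoidal category with tensor product $\otimes$, unit object $\mathbb 1$ and braiding $\Psi$, in which idempotents split. Algebras $(\mathrm m,\eta)$, coalgebras $(\Delta,\varepsilon)$ and bialgebras are taken in $\mathcal C$; in a bialgebra, $\Delta_B\circ\mathrm m_B=(\mathrm m_B\otimes\mathrm m_B)\circ(\mathrm{id}\otimes\Psi_{B,B}\otimes\mathrm{id})\circ(\Delta_B\otimes\Delta_B)$, $\Delta_B\eta_B=\eta_B\otimes\eta_B$, $\varepsilon_B\mathrm m_B=\varepsilon_B\otimes\varepsilon_B$, $\varepsilon_B\eta_B=\mathrm{id}_{\mathbb 1}$. ''$X\otimes X\xrightarrow{p}Y\xrightarrow{i}X\otimes X$ is a splitting of the idempotent $\Pi$'' means $p\circ i=\mathrm{id}_Y$ and $i\circ p=\Pi$. Cross product algebra: let $(B_1,\mathrm m_1,\eta_1)$ be an algebra, $B_2$ an object, and $\eta_2:\mathbb 1\to B_2$, $\varphi_{2,1}:B_2\otimes B_1\to B_1\otimes B_2$, $\hat\sigma:B_2\otimes B_2\to B_1\otimes B_2$ morphisms with $\varphi_{2,1}=(\mathrm m_1\otimes\mathrm{id}_{B_2})\circ(\mathrm{id}_{B_1}\otimes\hat\sigma)\circ(\varphi_{2,1}\otimes\eta_2)$. If $B_1\otimes B_2$ is an algebra with multiplication $(\mathrm m_1\otimes\mathrm{id}_{B_2})\circ(\mathrm m_1\otimes\hat\sigma)\circ(\mathrm{id}_{B_1}\otimes\varphi_{2,1}\otimes\mathrm{id}_{B_2})$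 and unit $\eta_1\otimes\eta_2$, it is called a cross product algebra. Cross product coalgebra: let $(B_2,\Delta_2,\varepsilon_2)$ be a coalgebra, $B_1$ an object, and $\varepsilon_1:B_1\to\mathbb 1$, $\varphi_{1,2}:B_1\otimes B_2\to B_2\otimes B_1$, $\hat\rho:B_1\otimes B_2\to B_1\otimes B_1$ morphisms with $\varphi_{1,2}=(\varepsilon_1\otimes\varphi_{1,2})\circ(\hat\rho\otimes\mathrm{id}_{B_2})\circ(\mathrm{id}_{B_1}\otimes\Delta_2)$. If $B_1\otimes B_2$ is a coalgebra with comultiplication $(\mathrm{id}_{B_1}\otimes\varphi_{1,2}\otimes\mathrm{id}_{B_2})\circ(\hat\rho\otimes\Delta_2)\circ(\mathrm{id}_{B_1}\otimes\Delta_2)$ and counit $\varepsilon_1\otimes\varepsilon_2$, it is called a cross product coalgebra. Cross product bialgebra: a bialgebra whose underlying algebra is a cross product algebra and whose underlying coalgebra is a cross product coalgebra on the same objects $B_1,B_2$. It is normalized if $\varepsilon_1\circ\eta_1=\mathrm{id}_{\mathbb 1}$ (equivalently $\varepsilon_2\circ\eta_2=\mathrm{id}_{\mathbb 1}$). Cocycle cross product bialgebra: a normalized cross product bialgebra together with additional morphisms $\Delta_1:B_1\to B_1\otimes B_1$, $\mathrm m_2:B_2\otimes B_2\to B_2$, $\mu_l:B_2\otimes B_1\to B_1$, $\mu_r:B_2\otimes B_1\to B_2$, $\nu_l:B_1\to B_2\otimes B_1$, $\nu_r:B_2\to B_2\otimes B_1$, $\sigma:B_2\otimes B_2\to B_1$,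 $\rho:B_2\to B_1\otimes B_1$ such that $$\varphi_{1,2}=(\mathrm m_2\otimes\mathrm m_1)(\mathrm{id}_{B_2}\otimes\Psi_{B_1,B_2}\otimes\mathrm{id}_{B_1})(\nu_l\otimes\nu_r),$$ $$\varphi_{2,1}=(\mu_l\otimes\mu_r)(\mathrm{id}_{B_2}\otimes\Psi_{B_2,B_1}\otimes\mathrm{id}_{B_1})(\Delta_2\otimes\Delta_1),$$ $$\hat\sigma=(\sigma\otimes\mathrm m_2(\mu_r\otimes\mathrm{id}_{B_2}))(\mathrm{id}_{B_2}\otimes\Psi_{B_2,B_2}\otimes\mathrm{id}_{B_1\otimes B_2})(\Delta_2\otimes(\nu_r\otimes\mathrm{id}_{B_2})\Delta_2),$$ $$\hat\rho=(\mathrm m_1(\mathrm{id}_{B_1}\otimes\mu_l)\otimes\mathrm m_1)(\mathrm{id}_{B_1\otimes B_2}\otimes\Psi_{B_1,B_1}\otimes\mathrm{id}_{B_1})((\mathrm{id}_{B_1}\otimes\nu_l)\Delta_1\otimes\rho);$$ the (co)unital identities $\Delta_1\eta_1=\eta_1\otimes\eta_1$, $(\mathrm{id}\otimes\varepsilon_1)\Delta_1=(\varepsilon_1\otimes\mathrm{id})\Delta_1=\mathrm{id}_{B_1}$, $\varepsilon_2\mathrm m_2=\varepsilon_2\otimes\varepsilon_2$, $\mathrm m_2(\mathrm{id}\otimes\eta_2)=\mathrm m_2(\eta_2\otimes\mathrm{id})=\mathrm{id}_{B_2}$, $\mu_l(\eta_2\otimes\mathrm{id})=\mathrm{id}_{B_1}$,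 $\mu_l(\mathrm{id}\otimes\eta_1)=\eta_1\varepsilon_2$, $\varepsilon_1\mu_l=\varepsilon_2\otimes\varepsilon_1$, $\mu_r(\mathrm{id}\otimes\eta_1)=\mathrm{id}_{B_2}$, $\mu_r(\eta_2\otimes\mathrm{id})=\eta_2\varepsilon_1$, $\varepsilon_2\mu_r=\varepsilon_2\otimes\varepsilon_1$, $(\varepsilon_2\otimes\mathrm{id})\nu_l=\mathrm{id}_{B_1}$, $(\mathrm{id}\otimes\varepsilon_1)\nu_l=\eta_2\varepsilon_1$, $\nu_l\eta_1=\eta_2\otimes\eta_1$, $(\mathrm{id}\otimes\varepsilon_1)\nu_r=\mathrm{id}_{B_2}$, $(\varepsilon_2\otimes\mathrm{id})\nu_r=\eta_1\varepsilon_2$, $\nu_r\eta_2=\eta_2\otimes\eta_1$; and the relations $$(\mathrm m_2\otimes\mathrm{id}_{B_1})(\mathrm{id}_{B_2}\otimes\nu_r)=(\mathrm m_2\otimes\mathrm{id}_{B_1})(\mu_r\otimes\varphi_{1,2})(\mathrm{id}_{B_2}\otimes(\rho\otimes\mathrm{id}_{B_2})\Delta_2),$$ $$(\mu_l\otimes\mathrm{id}_{B_1})(\mathrm{id}_{B_2}\otimes\Delta_1)=(\mathrm m_1(\mathrm{id}_{B_1}\otimes\sigma)\otimes\mathrm{id}_{B_1})(\varphi_{2,1}\otimes\nu_l)(\mathrm{id}_{B_2}\otimes\Delta_1).$$ Juxtaposition denotes composition. *)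

(* Defs.v *)
Set Implicit Arguments.
Unset Strict Implicit.
Unset Printing Implicit Defensive.

(* Categories are given by a type of objects and a single type of morphisms
   with domain and codomain maps, so that strict associativity of the tensor
   product of morphisms is a plain equation, with no transport along equalities
   of objects.  [comp g f] is only meaningful when [cod f = dom g]; nothing is
   assumed about the other values. *)
Record category := Category {
  Ob : Type;
  Mor : Type;
  dom : Mor -> Ob;
  cod : Mor -> Ob;
  idm : Ob -> Mor;
  comp : Mor -> Mor -> Mor;
  dom_id : forall A, dom (idm A) = A;
  cod_id : forall A, cod (idm A) = A;
  dom_comp : forall g f, cod f = dom g -> dom (comp g f) = dom f;
  cod_comp : forall g f, cod f = dom g -> cod (comp g f) = cod g;
  comp_idl : forall f, comp (idm (cod f)) f = f;
  comp_idr : forall f, comp f (idm (dom f)) = f;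
  comp_assoc : forall h g f, cod f = dom g -> cod g = dom h ->
    comp h (comp g f) = comp (comp h g) f
}.

Arguments dom {c} f.
Arguments cod {c} f.
Arguments idm {c} A.
Arguments comp {c} g f.

Notation "g ∘ f" := (comp g f) (at level 40, left associativity).

Definition hom {C : category} (A B : Ob C) (f : Mor C) : Prop :=
  dom f = A /\ cod f = B.

Notation "f ⦂ A ⟶ B" := (hom A B f)
  (at level 70, A at next level, B at next level).

Record strict_monoidal_category := StrictMonoidalCategory {
  smc_cat :> category;
  tens_ob : Ob smc_cat -> Ob smc_cat -> Ob smc_cat;
  unit_ob : Ob smc_cat;
  tens : Mor smc_cat -> Mor smc_cat -> Mor smc_cat;
  dom_tens : forall f g, dom (tens f g) = tens_ob (dom f) (dom g);
  cod_tens : forall f g, cod (tens f g) = tens_ob (cod f) (cod g);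
  tens_id : forall A B, tens (idm A) (idm B) = idm (tens_ob A B);
  tens_comp : forall g f g' f', cod f = dom g -> cod f' = dom g' ->
    tens (g ∘ f) (g' ∘ f') = tens g g' ∘ tens f f';
  tens_ob_assoc : forall X Y Z,
    tens_ob X (tens_ob Y Z) = tens_ob (tens_ob X Y) Z;
  tens_ob_unitl : forall X, tens_ob unit_ob X = X;
  tens_ob_unitr : forall X, tens_ob X unit_ob = X;
  tens_assoc : forall f g h, tens f (tens g h) = tens (tens f g) h;
  tens_unitl : forall f, tens (idm unit_ob) f = f;
  tens_unitr : forall f, tens f (idm unit_ob) = f
}.

Arguments tens_ob {s} X Y.
Arguments unit_ob {s}.
Arguments tens {s} f g.

Notation "X ⊠ Y" := (tens_ob X Y) (at level 38, left associativity).
Notation "f ⊗ g" := (tens f g) (at level 38, left associativity).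
Notation "𝟙" := unit_ob.

Definition mutually_inverse {C : category} (A B : Ob C) (f g : Mor C) : Prop :=
  f ⦂ A ⟶ B /\ g ⦂ B ⟶ A /\ g ∘ f = idm A /\ f ∘ g = idm B.

Record strict_braided_category := StrictBraidedCategory {
  sbc_smc :> strict_monoidal_category;
  braid : Ob sbc_smc -> Ob sbc_smc -> Mor sbc_smc;
  braid_hom : forall X Y, braid X Y ⦂ X ⊠ Y ⟶ Y ⊠ X;
  braid_iso : forall X Y, exists g, mutually_inverse (X ⊠ Y) (Y ⊠ X) (braid X Y) g;
  braid_natural : forall f g,
    braid (cod f) (cod g) ∘ (f ⊗ g) = (g ⊗ f) ∘ braid (dom f) (dom g);
  braid_tensl : forall X Y Z,
    braid (X ⊠ Y) Z = (braid X Z ⊗ idm Y) ∘ (idm X ⊗ braid Y Z);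
  braid_tensr : forall X Y Z,
    braid X (Y ⊠ Z) = (idm Y ⊗ braid X Z) ∘ (braid X Y ⊗ idm Z)
}.

Arguments braid {s} X Y.

Notation Ψ := braid.

Definition idempotent {C : category} (A : Ob C) (e : Mor C) : Prop :=
  e ⦂ A ⟶ A /\ e ∘ e = e.

(* [X --p--> Y --i--> X] is a splitting of [e]. *)
Definition is_splitting {C : category} (X Y : Ob C) (p i e : Mor C) : Prop :=
  p ⦂ X ⟶ Y /\ i ⦂ Y ⟶ X /\ p ∘ i = idm Y /\ i ∘ p = e.

Definition idempotents_split (C : category) : Prop :=
  forall (X : Ob C) (e : Mor C), idempotent X e ->
    exists Y p i, is_splitting X Y p i e.

Record is_algebra {C : strict_monoidal_category} (A : Ob C) (m η : Mor C) :
    Prop := IsAlgebra {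
  alg_mul_hom : m ⦂ A ⊠ A ⟶ A;
  alg_unit_hom : η ⦂ 𝟙 ⟶ A;
  alg_assoc : m ∘ (m ⊗ idm A) = m ∘ (idm A ⊗ m);
  alg_unitl : m ∘ (η ⊗ idm A) = idm A;
  alg_unitr : m ∘ (idm A ⊗ η) = idm A
}.

Record is_coalgebra {C : strict_monoidal_category} (A : Ob C) (Δ ε : Mor C) :
    Prop := IsCoalgebra {
  coalg_comul_hom : Δ ⦂ A ⟶ A ⊠ A;
  coalg_counit_hom : ε ⦂ A ⟶ 𝟙;
  coalg_coassoc : (Δ ⊗ idm A) ∘ Δ = (idm A ⊗ Δ) ∘ Δ;
  coalg_counitl : (ε ⊗ idm A) ∘ Δ = idm A;
  coalg_counitr : (idm A ⊗ ε) ∘ Δ = idm A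
}.

Record algebra_morphism {C : strict_monoidal_category}
    (A : Ob C) (mA ηA : Mor C) (B : Ob C) (mB ηB : Mor C) (f : Mor C) :
    Prop := AlgebraMorphism {
  alg_mor_hom : f ⦂ A ⟶ B;
  alg_mor_mul : f ∘ mA = mB ∘ (f ⊗ f);
  alg_mor_unit : f ∘ ηA = ηB
}.

Record coalgebra_morphism {C : strict_monoidal_category}
    (A : Ob C) (ΔA εA : Mor C) (B : Ob C) (ΔB εB : Mor C) (f : Mor C) :
    Prop := CoalgebraMorphism {
  coalg_mor_hom : f ⦂ A ⟶ B;
  coalg_mor_comul : ΔB ∘ f = (f ⊗ f) ∘ ΔA;
  coalg_mor_counit : εB ∘ f = εA
}.

Record bialgebra_data (C : category) := BialgebraData {
  carrier :> Ob C;
  mul : Mor C;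
  eta : Mor C;
  comul : Mor C;
  eps : Mor C
}.

Arguments mul {C} b.
Arguments eta {C} b.
Arguments comul {C} b.
Arguments eps {C} b.

Record is_bialgebra {C : strict_braided_category} (B : bialgebra_data C) :
    Prop := IsBialgebra {
  bialg_algebra : is_algebra B (mul B) (eta B);
  bialg_coalgebra : is_coalgebra B (comul B) (eps B);
  bialg_comul_mul : comul B ∘ mul B =
    (mul B ⊗ mul B) ∘ (idm B ⊗ Ψ B B ⊗ idm B) ∘ (comul B ⊗ comul B);
  bialg_comul_eta : comul B ∘ eta B = eta B ⊗ eta B;
  bialg_eps_mul : eps B ∘ mul B = eps B ⊗ eps B;
  bialg_eps_eta : eps B ∘ eta B = idm 𝟙
}.

Definition bialgebra_iso {C : strict_braided_category}
    (X B : bialgebra_data C) (f : Mor C) : Prop :=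
  (exists g, mutually_inverse X B f g) /\
  algebra_morphism X (mul X) (eta X) B (mul B) (eta B) f /\
  coalgebra_morphism X (comul X) (eps X) B (comul B) (eps B) f.

(* [hσ] and [hρ] stand for σ and ρ with a hat. *)
Definition cp_mul {C : strict_monoidal_category} (B1 B2 : Ob C)
    (m1 φ21 hσ : Mor C) : Mor C :=
  (m1 ⊗ idm B2) ∘ (m1 ⊗ hσ) ∘ (idm B1 ⊗ φ21 ⊗ idm B2).

Definition cp_comul {C : strict_monoidal_category} (B1 B2 : Ob C)
    (Δ2 φ12 hρ : Mor C) : Mor C :=
  (idm B1 ⊗ φ12 ⊗ idm B2) ∘ (hρ ⊗ Δ2) ∘ (idm B1 ⊗ Δ2).

Record cross_product_algebra {C : strict_monoidal_category} (B1 B2 : Ob C)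
    (m1 η1 η2 φ21 hσ : Mor C) : Prop := CrossProductAlgebra {
  cpa_algebra1 : is_algebra B1 m1 η1;
  cpa_eta2_hom : η2 ⦂ 𝟙 ⟶ B2;
  cpa_phi21_hom : φ21 ⦂ B2 ⊠ B1 ⟶ B1 ⊠ B2;
  cpa_hsigma_hom : hσ ⦂ B2 ⊠ B2 ⟶ B1 ⊠ B2;
  cpa_phi21 : φ21 = (m1 ⊗ idm B2) ∘ (idm B1 ⊗ hσ) ∘ (φ21 ⊗ η2);
  cpa_algebra : is_algebra (B1 ⊠ B2) (cp_mul B1 B2 m1 φ21 hσ) (η1 ⊗ η2)
}.

Record cross_product_coalgebra {C : strict_monoidal_category} (B1 B2 : Ob C)
    (Δ2 ε2 ε1 φ12 hρ : Mor C) : Prop := CrossProductCoalgebra {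
  cpc_coalgebra2 : is_coalgebra B2 Δ2 ε2;
  cpc_eps1_hom : ε1 ⦂ B1 ⟶ 𝟙;
  cpc_phi12_hom : φ12 ⦂ B1 ⊠ B2 ⟶ B2 ⊠ B1;
  cpc_hrho_hom : hρ ⦂ B1 ⊠ B2 ⟶ B1 ⊠ B1;
  cpc_phi12 : φ12 = (ε1 ⊗ φ12) ∘ (hρ ⊗ idm B2) ∘ (idm B1 ⊗ Δ2);
  cpc_coalgebra : is_coalgebra (B1 ⊠ B2) (cp_comul B1 B2 Δ2 φ12 hρ) (ε1 ⊗ ε2)
}.

Record cross_product_data (C : category) := CrossProductData {
  cp_B1 : Ob C;
  cp_B2 : Ob C;
  cp_m1 : Mor C;
  cp_η1 : Mor C;
  cp_η2 : Mor C;
  cp_φ21 : Mor C;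
  cp_hσ : Mor C;
  cp_Δ2 : Mor C;
  cp_ε2 : Mor C;
  cp_ε1 : Mor C;
  cp_φ12 : Mor C;
  cp_hρ : Mor C
}.

Definition cp_bialgebra_data {C : strict_monoidal_category}
    (X : cross_product_data C) : bialgebra_data C :=
  let 'CrossProductData B1 B2 m1 η1 η2 φ21 hσ Δ2 ε2 ε1 φ12 hρ := X in
  BialgebraData (B1 ⊠ B2)
    (cp_mul B1 B2 m1 φ21 hσ) (η1 ⊗ η2)
    (cp_comul B1 B2 Δ2 φ12 hρ) (ε1 ⊗ ε2).

Definition cross_product_bialgebra {C : strict_braided_category}
    (X : cross_product_data C) : Prop :=
  let 'CrossProductData B1 B2 m1 η1 η2 φ21 hσ Δ2 ε2 ε1 φ12 hρ := X in
  cross_product_algebra B1 B2 m1 η1 η2 φ21 hσ /\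
  cross_product_coalgebra B1 B2 Δ2 ε2 ε1 φ12 hρ /\
  is_bialgebra (cp_bialgebra_data X).

Definition normalized {C : strict_monoidal_category}
    (X : cross_product_data C) : Prop :=
  cp_ε1 X ∘ cp_η1 X = idm 𝟙.

Record cocycle_relations {C : strict_braided_category} (B1 B2 : Ob C)
    (m1 η1 η2 φ21 hσ Δ2 ε2 ε1 φ12 hρ Δ1 m2 μl μr νl νr σ ρ : Mor C) :
    Prop := CocycleRelations {
  ccp_Δ1_hom : Δ1 ⦂ B1 ⟶ B1 ⊠ B1;
  ccp_m2_hom : m2 ⦂ B2 ⊠ B2 ⟶ B2;
  ccp_μl_hom : μl ⦂ B2 ⊠ B1 ⟶ B1;
  ccp_μr_hom : μr ⦂ B2 ⊠ B1 ⟶ B2;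
  ccp_νl_hom : νl ⦂ B1 ⟶ B2 ⊠ B1;
  ccp_νr_hom : νr ⦂ B2 ⟶ B2 ⊠ B1;
  ccp_σ_hom : σ ⦂ B2 ⊠ B2 ⟶ B1;
  ccp_ρ_hom : ρ ⦂ B2 ⟶ B1 ⊠ B1;

  ccp_φ12 : φ12 = (m2 ⊗ m1) ∘ (idm B2 ⊗ Ψ B1 B2 ⊗ idm B1) ∘ (νl ⊗ νr);
  ccp_φ21 : φ21 = (μl ⊗ μr) ∘ (idm B2 ⊗ Ψ B2 B1 ⊗ idm B1) ∘ (Δ2 ⊗ Δ1);
  ccp_hσ : hσ =
    (σ ⊗ (m2 ∘ (μr ⊗ idm B2)))
    ∘ (idm B2 ⊗ Ψ B2 B2 ⊗ idm (B1 ⊠ B2))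
    ∘ (Δ2 ⊗ ((νr ⊗ idm B2) ∘ Δ2));
  ccp_hρ : hρ =
    ((m1 ∘ (idm B1 ⊗ μl)) ⊗ m1)
    ∘ (idm (B1 ⊠ B2) ⊗ Ψ B1 B1 ⊗ idm B1)
    ∘ (((idm B1 ⊗ νl) ∘ Δ1) ⊗ ρ);

  ccp_Δ1_η1 : Δ1 ∘ η1 = η1 ⊗ η1;
  ccp_Δ1_counitr : (idm B1 ⊗ ε1) ∘ Δ1 = idm B1;
  ccp_Δ1_counitl : (ε1 ⊗ idm B1) ∘ Δ1 = idm B1;
  ccp_ε2_m2 : ε2 ∘ m2 = ε2 ⊗ ε2;
  ccp_m2_unitr : m2 ∘ (idm B2 ⊗ η2) = idm B2;
  ccp_m2_unitl : m2 ∘ (η2 ⊗ idm B2) = idm B2;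
  ccp_μl_η2 : μl ∘ (η2 ⊗ idm B1) = idm B1;
  ccp_μl_η1 : μl ∘ (idm B2 ⊗ η1) = η1 ∘ ε2;
  ccp_ε1_μl : ε1 ∘ μl = ε2 ⊗ ε1;
  ccp_μr_η1 : μr ∘ (idm B2 ⊗ η1) = idm B2;
  ccp_μr_η2 : μr ∘ (η2 ⊗ idm B1) = η2 ∘ ε1;
  ccp_ε2_μr : ε2 ∘ μr = ε2 ⊗ ε1;
  ccp_ε2_νl : (ε2 ⊗ idm B1) ∘ νl = idm B1;
  ccp_ε1_νl : (idm B2 ⊗ ε1) ∘ νl = η2 ∘ ε1;
  ccp_νl_η1 : νl ∘ η1 = η2 ⊗ η1;
  ccp_ε1_νr : (idm B2 ⊗ ε1) ∘ νr = idm B2;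
  ccp_ε2_νr : (ε2 ⊗ idm B1) ∘ νr = η1 ∘ ε2;
  ccp_νr_η2 : νr ∘ η2 = η2 ⊗ η1;

  ccp_m2_νr : (m2 ⊗ idm B1) ∘ (idm B2 ⊗ νr) =
    (m2 ⊗ idm B1) ∘ (μr ⊗ φ12) ∘ (idm B2 ⊗ ((ρ ⊗ idm B2) ∘ Δ2));
  ccp_μl_Δ1 : (μl ⊗ idm B1) ∘ (idm B2 ⊗ Δ1) =
    ((m1 ∘ (idm B1 ⊗ σ)) ⊗ idm B1) ∘ (φ21 ⊗ νl) ∘ (idm B2 ⊗ Δ1)
}.

Definition cocycle_cross_product_bialgebra {C : strict_braided_category}
    (X : cross_product_data C) : Prop :=
  cross_product_bialgebra X /\ normalized X /\
  exists Δ1 m2 μl μr νl νr σ ρ : Mor C,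
    let 'CrossProductData B1 B2 m1 η1 η2 φ21 hσ Δ2 ε2 ε1 φ12 hρ := X in
    cocycle_relations B1 B2 m1 η1 η2 φ21 hσ Δ2 ε2 ε1 φ12 hρ
      Δ1 m2 μl μr νl νr σ ρ.

Section Projections.

Context {C : strict_braided_category} (B : bialgebra_data C).

(* In [gamma] and [delta] the indices are replaced by the idempotents they
   stand for: γ_j is [gamma Π_j] and δ_(i,j,k) is [delta Π_i Π_j Π_k], with
   Π_0 the identity of [B]. *)
Definition gamma (Π : Mor C) : Mor C :=
  (mul B ⊗ mul B) ∘ (idm B ⊗ Π ⊗ idm B ⊗ idm B)
  ∘ (idm B ⊗ Ψ B B ⊗ idm B) ∘ (comul B ⊗ comul B).

Definition delta (Πi Πj Πk : Mor C) : Mor C :=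
  (mul B ⊗ idm B) ∘ (Πi ⊗ Πj ⊗ Πk) ∘ (idm B ⊗ comul B).

Definition delta_relation (Π : Mor C) : Prop :=
  (Π ⊗ idm B) ∘ delta (idm B) (idm B) (idm B) ∘ (idm B ⊗ Π) =
  (Π ⊗ idm B) ∘ delta (idm B) Π (idm B) ∘ (idm B ⊗ Π).

Record projection_relations (Π1 Π2 : Mor C) : Prop := ProjectionRelations {
  proj_gamma1 : (idm B ⊗ Π1) ∘ comul B =
    delta Π1 Π2 Π1 ∘ gamma Π1 ∘ (Π1 ⊗ Π2) ∘ comul B;
  proj_gamma2 : mul B ∘ (Π2 ⊗ idm B) =
    mul B ∘ (Π1 ⊗ Π2) ∘ gamma Π2 ∘ delta Π2 Π1 Π2;
  proj_delta1 : delta_relation Π1;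
  proj_delta2 : delta_relation Π2
}.

Definition iso_to_cocycle_cross_product : Prop :=
  exists (X : cross_product_data C) (f : Mor C),
    cocycle_cross_product_bialgebra X /\
    bialgebra_iso B (cp_bialgebra_data X) f.

Definition has_projection_idempotents : Prop :=
  exists Π1 Π2 : Mor C,
    idempotent B Π1 /\ idempotent B Π2 /\
    mul B ∘ (Π1 ⊗ Π1) = Π1 ∘ mul B ∘ (Π1 ⊗ Π1) /\
    Π1 ∘ eta B = eta B /\
    (Π2 ⊗ Π2) ∘ comul B = (Π2 ⊗ Π2) ∘ comul B ∘ Π2 /\
    eps B ∘ Π2 = eps B /\
    is_splitting (B ⊠ B) B
      (mul B ∘ (Π1 ⊗ Π2)) ((Π1 ⊗ Π2) ∘ comul B) (Π1 ⊗ Π2) /\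
    projection_relations Π1 Π2.

Definition has_projection_factors : Prop :=
  exists (B1 : Ob C) (m1 η1 : Mor C) (B2 : Ob C) (Δ2 ε2 : Mor C)
      (i1 p1 i2 p2 : Mor C),
    is_algebra B1 m1 η1 /\ is_coalgebra B2 Δ2 ε2 /\
    i1 ⦂ B1 ⟶ B /\ p1 ⦂ B ⟶ B1 /\ i2 ⦂ B2 ⟶ B /\ p2 ⦂ B ⟶ B2 /\
    algebra_morphism B1 m1 η1 B (mul B) (eta B) i1 /\
    coalgebra_morphism B (comul B) (eps B) B2 Δ2 ε2 p2 /\
    p1 ∘ i1 = idm B1 /\ p2 ∘ i2 = idm B2 /\
    mutually_inverse (B1 ⊠ B2) B
      (mul B ∘ (i1 ⊗ i2)) ((p1 ⊗ p2) ∘ comul B) /\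
    projection_relations (i1 ∘ p1) (i2 ∘ p2).

End Projections.

(* Main.v *)
Require Import Defs.
From Stdlib Require Import List Bool Arith.
Import ListNotations.

(** The second and third statements differ by splitting the idempotents. For the
    equivalence of the first and the third, call factorization a pair of
    retracts B1 and B2 of B, the first a subalgebra and the second a quotient
    coalgebra, such that m (i1 ⊗ i2) and (p1 ⊗ p2) Δ are mutually inverse. In
    other words every b is uniquely a product b1 b2. Two consequences drive the
    whole argument. First, p1 is left B1-linear and p2 is a morphism of right
    B-modules onto B / B1^+ B ([p1_mul_i1], [p2_mul_i2_p2]). Dually, B1 is a
    left coideal and B2 satisfies a colinearity condition ([comul_p1_i1],
    [comul_p2_i2]).

    A factorization alone makes B a cross product bialgebra on B1 ⊗ B2, the
    morphisms φ and the hatted σ and ρ being the composites that factor a product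
    of elements of B2 and B1, or of B2 and B2, and their duals
    ([cross_product_bialgebra_of_factorization]). Conversely a cross product
    algebra determines these morphisms by restriction of its product to the
    factors ([cp_mul_i2_i1], [cp_mul_i2_i2]), and in a cocycle cross product the
    counit identities show that μl, μr, σ, m2 and their duals are likewise
    restrictions and projections of the structure of B
    ([canonical_cocycle_relations_of_cross_product]). So both statements concern
    the same factorization, and it remains to compare the projection relations
    with the cocycle relations.

    There (δ1) is equivalent to the relation between μl and Δ1, and it implies the
    formula for φ21; (γ2) is equivalent to the formula for the hatted σ
    ([delta_relation_iff_mul_comul_relation], [phi_relation_of_delta_relation],
    [gamma2_relation_iff_sigma_relation]). In both equivalences the cocycle side
    is the projection relation with one argument taken in B2, and the general
    case follows by writing that argument as a product b1 b2 and using that p1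
    is B1-linear. The statements on (δ2), (γ1) and the comultiplication follow
    by duality: reversing both the composition and the tensor product of the
    category exchanges the roles of B1 and B2. *)

(** * Planar diagrams and rewriting modulo the exchange law *)

(** Equations between composites are proved by reflection. An expression is
    flattened to the sequence of layers of its string diagram, and two
    expressions are equal as soon as their sequences have the same normal form
    under the exchange law (g ⊗ 1)(1 ⊗ f) = (1 ⊗ f)(g ⊗ 1). Naturality of the
    braiding and all other relations are left to explicit rewriting steps, for
    which a subdiagram is first isolated by exchanges. *)

Section Diagrams.

Context {C : strict_monoidal_category} (obs : list (Ob C)).

Inductive wires := WAtom (n : nat) | WUnit | WTens (v w : wires).

Definition ob_at (n : nat) : Ob C := nth n obs 𝟙.

Fixpoint ev_wires (w : wires) : Ob C :=
  match w with
  | WAtom n => ob_at n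
  | WUnit => 𝟙
  | WTens v w => ev_wires v ⊠ ev_wires w
  end.

Fixpoint flat (w : wires) : list nat :=
  match w with
  | WAtom n => [n]
  | WUnit => []
  | WTens v w => flat v ++ flat w
  end.

Fixpoint ten (l : list nat) : Ob C :=
  match l with [] => 𝟙 | n :: l => ob_at n ⊠ ten l end.

Lemma ten_app k l : ten (k ++ l) = ten k ⊠ ten l.
Proof.
  induction k as [|n k IH]; simpl.
  - now rewrite tens_ob_unitl.
  - now rewrite IH, tens_ob_assoc.
Qed.

Lemma ten_flat w : ten (flat w) = ev_wires w.
Proof.
  induction w as [n| |v IHv w IHw]; simpl.
  - apply tens_ob_unitr.
  - reflexivity.
  - now rewrite ten_app, IHv, IHw.
Qed.

Record gen := Gen {
  gen_mor : Mor C;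
  gen_dom : wires;
  gen_cod : wires;
  gen_hom : gen_mor ⦂ ev_wires gen_dom ⟶ ev_wires gen_cod
}.

Context (gens : list gen).

Inductive expr :=
  | EGen (n : nat)
  | EId (w : wires)
  | EComp (e e' : expr)
  | ETens (e e' : expr).

Definition mor_at (n : nat) : Mor C :=
  match nth_error gens n with Some g => gen_mor g | None => idm 𝟙 end.

Fixpoint ev (e : expr) : Mor C :=
  match e with
  | EGen n => mor_at n
  | EId w => idm (ev_wires w)
  | EComp e e' => ev e ∘ ev e'
  | ETens e e' => ev e ⊗ ev e'
  end.

Definition arity (g : gen) : list nat * list nat :=
  (flat (gen_dom g), flat (gen_cod g)).

(** One generator [gn], with the wires [pre] and [post] passing on its left and
    on its right. The arity [gin], [gout] is repeated in the layer so that
    exchanging layers does not look generators up. *)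
Record layer := Layer {
  pre : list nat;
  gn : nat;
  gin : list nat;
  gout : list nat;
  post : list nat
}.

Definition ldom (x : layer) := pre x ++ gin x ++ post x.
Definition lcod (x : layer) := pre x ++ gout x ++ post x.

Definition ev_layer (x : layer) : Mor C :=
  idm (ten (pre x)) ⊗ (mor_at (gn x) ⊗ idm (ten (post x))).

Definition valid (x : layer) : Prop :=
  mor_at (gn x) ⦂ ten (gin x) ⟶ ten (gout x).

Fixpoint ev_layers (d : list nat) (l : list layer) : Mor C :=
  match l with
  | [] => idm (ten d)
  | x :: l => ev_layers (lcod x) l ∘ ev_layer x
  end.

Fixpoint wf (d : list nat) (l : list layer) : Prop :=
  match l with
  | [] => True
  | x :: l => valid x /\ ldom x = d /\ wf (lcod x) l
  end.

Fixpoint target (d : list nat) (l : list layer) : list nat :=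
  match l with [] => d | x :: l => target (lcod x) l end.

Lemma ev_layer_hom x : valid x -> ev_layer x ⦂ ten (ldom x) ⟶ ten (lcod x).
Proof.
  intros [Hd Hc]; unfold ev_layer, ldom, lcod; split.
  - now rewrite !dom_tens, !dom_id, Hd, !ten_app.
  - now rewrite !cod_tens, !cod_id, Hc, !ten_app.
Qed.

Lemma ev_layers_hom l d : wf d l -> ev_layers d l ⦂ ten d ⟶ ten (target d l).
Proof.
  revert d; induction l as [|x l IH]; intros d; simpl.
  - now split; rewrite ?dom_id, ?cod_id.
  - intros (Hx & <- & Hl).
    destruct (IH _ Hl) as [Id Ic], (ev_layer_hom x Hx) as [Xd Xc].
    split.
    + rewrite dom_comp; congruence.
    + rewrite cod_comp; congruence.
Qed.

Lemma ev_layers_app k l d :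
  wf d k -> wf (target d k) l ->
  ev_layers d (k ++ l) = ev_layers (target d k) l ∘ ev_layers d k /\
  wf d (k ++ l) /\ target d (k ++ l) = target (target d k) l.
Proof.
  revert d; induction k as [|x k IH]; intros d; simpl.
  - intros _ Hl. destruct (ev_layers_hom l d Hl) as [E _].
    rewrite <- E, comp_idr; auto.
  - intros (Hx & <- & Hk) Hl.
    destruct (IH _ Hk Hl) as (-> & Hw & Ht).
    destruct (ev_layers_hom _ _ Hk), (ev_layers_hom _ _ Hl), (ev_layer_hom x Hx).
    rewrite comp_assoc by congruence; auto.
Qed.

Definition whisker (a b : list nat) (x : layer) : layer :=
  Layer (a ++ pre x) (gn x) (gin x) (gout x) (post x ++ b).

Lemma ev_whisker a b x :
  ev_layer (whisker a b x) = idm (ten a) ⊗ ev_layer x ⊗ idm (ten b).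
Proof.
  unfold ev_layer; simpl.
  now rewrite !ten_app, <- !tens_id, !tens_assoc.
Qed.

Lemma whisker_layers a b l d :
  wf d l ->
  ev_layers (a ++ d ++ b) (map (whisker a b) l) =
    idm (ten a) ⊗ ev_layers d l ⊗ idm (ten b) /\
  wf (a ++ d ++ b) (map (whisker a b) l) /\
  target (a ++ d ++ b) (map (whisker a b) l) = a ++ target d l ++ b.
Proof.
  assert (Hs : forall u v w, a ++ u ++ v ++ w ++ b = a ++ (u ++ v ++ w) ++ b)
    by (intros; now rewrite !app_assoc).
  revert d; induction l as [|x l IH]; intros d; simpl.
  - now rewrite !ten_app, <- !tens_id, tens_assoc.
  - intros (Hx & <- & Hl).
    assert (Ed : ldom (whisker a b x) = a ++ ldom x ++ b)
      by (unfold ldom; simpl; now rewrite <- !app_assoc).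
    assert (Ec : lcod (whisker a b x) = a ++ lcod x ++ b)
      by (unfold lcod; simpl; now rewrite <- !app_assoc).
    destruct (IH _ Hl) as (E & Hw & Ht).
    rewrite Ec; split; [|now auto].
    rewrite E, ev_whisker.
    destruct (ev_layers_hom _ _ Hl) as [Ld Lc], (ev_layer_hom x Hx) as [Xd Xc].
    assert (Ei : forall A, idm A = idm A ∘ idm A :> Mor C).
    { intros A. rewrite <- (cod_id A) at 2. now rewrite comp_idl. }
    rewrite (Ei (ten a)), (Ei (ten b)) at 3.
    rewrite !tens_comp; rewrite ?cod_tens, ?dom_tens, ?cod_id, ?dom_id; congruence.
Qed.

Fixpoint strip (k l : list nat) : option (list nat) :=
  match k, l with
  | [], _ => Some l
  | x :: k, y :: l => if Nat.eqb x y then strip k l else None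
  | _, _ => None
  end.

Lemma strip_app k l m : strip k l = Some m -> l = k ++ m.
Proof.
  revert l; induction k as [|x k IH]; intros [|y l]; simpl; try congruence.
  destruct (Nat.eqb_spec x y) as [->|]; [|congruence].
  intros H; now rewrite (IH _ H).
Qed.

(** [exchange x y], for a layer [y] after a layer [x] and entirely to the left
    of it, is the same pair with [y] first. *)
Definition exchange (x y : layer) : option (layer * layer) :=
  match strip (pre y ++ gin y) (pre x) with
  | Some mid =>
      match strip (mid ++ gout x ++ post x) (post y) with
      | Some [] =>
          Some (Layer (pre y) (gn y) (gin y) (gout y) (mid ++ gin x ++ post x),
                Layer (pre y ++ gout y ++ mid) (gn x) (gin x) (gout x) (post x))
      | _ => None
      end
  | None => None
  end.

Lemma exchange_sound x y y' x' :
  exchange x y = Some (y', x') -> valid x -> valid y ->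
  valid y' /\ valid x' /\ ldom y' = ldom x /\ ldom x' = lcod y' /\
  lcod x' = lcod y /\ ev_layer x' ∘ ev_layer y' = ev_layer y ∘ ev_layer x.
Proof.
  unfold exchange.
  destruct (strip (pre y ++ gin y) (pre x)) as [mid|] eqn:E1; [|congruence].
  destruct (strip (mid ++ gout x ++ post x) (post y)) as [[|]|] eqn:E2;
    [|congruence..].
  apply strip_app in E1, E2; rewrite app_nil_r in E2.
  intros [= <- <-] Hx Hy.
  destruct x as [p f df cf q], y as [p' g dg cg q']; simpl in *; subst p q'.
  unfold valid, ldom, lcod, ev_layer in *; simpl in *.
  destruct Hx as [Hxd Hxc], Hy as [Hyd Hyc].
  do 2 (split; [split; assumption|]).
  do 3 (split; [now rewrite <- ?app_assoc|]).
  set (F := mor_at f) in *; set (G := mor_at g) in *.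
  rewrite !ten_app, <- !tens_id, <- Hxd, <- Hxc, <- Hyd, <- Hyc.
  rewrite <- !tens_assoc.
  assert (Ei : forall A, idm A ∘ idm A = idm A :> Mor C).
  { intros A. rewrite <- (cod_id A) at 1. now rewrite comp_idl. }
  rewrite <- !tens_comp;
    rewrite ?cod_tens, ?dom_tens, ?cod_id, ?dom_id; try reflexivity.
  now rewrite !Ei, !comp_idl, !comp_idr.
Qed.

(** The exchange law oriented so that the leftmost of two independent layers goes
    first; on connected diagrams this is terminating and confluent. *)
Fixpoint pass (x : layer) (l : list layer) : list layer :=
  match l with
  | [] => [x]
  | y :: l =>
      match exchange x y with
      | Some (y', x') => y' :: pass x' l
      | None => x :: pass y l
      end
  end.

Lemma pass_sound l x d :
  wf d (x :: l) ->
  wf d (pass x l) /\ target d (pass x l) = target d (x :: l) /\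
  ev_layers d (pass x l) = ev_layers d (x :: l).
Proof.
  revert x d; induction l as [|y l IH]; intros x d; [now auto|].
  intros (Hx & Hd & Hy & Hxy & Hl); cbn [pass].
  destruct (exchange x y) as [[y' x']|] eqn:E.
  - destruct (exchange_sound _ _ _ _ E Hx Hy)
      as (Vy & Vx & Dy & Dx & Cx & Ec).
    destruct (IH x' (lcod y')) as (Hw & Ht & He).
    { simpl; rewrite Cx; auto. }
    split; [simpl; rewrite Dy; auto|]. split.
    + simpl in *; rewrite Ht; now rewrite Cx.
    + simpl in *. rewrite He, Cx.
      destruct (ev_layers_hom _ _ Hl).
      destruct (ev_layer_hom _ Hx), (ev_layer_hom _ Hy),
        (ev_layer_hom _ Vx), (ev_layer_hom _ Vy).
      rewrite <- !comp_assoc by congruence. now rewrite Ec.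
  - destruct (IH y (lcod x)) as (Hw & Ht & He); [simpl; auto|].
    simpl in *; rewrite Ht, He; auto.
Qed.

Fixpoint normalize (fuel : nat) (l : list layer) : list layer :=
  match fuel, l with
  | S fuel, x :: l => normalize fuel (pass x l)
  | _, _ => l
  end.

Lemma normalize_sound n l d :
  wf d l -> ev_layers d (normalize n l) = ev_layers d l.
Proof.
  revert l; induction n as [|n IH]; intros [|x l]; try reflexivity.
  intros H; simpl normalize; destruct (pass_sound _ _ _ H) as (Hw & _ & He).
  now rewrite IH.
Qed.

Definition eq_wires (k l : list nat) : bool :=
  match strip k l with Some [] => true | _ => false end.

Lemma eq_wires_eq k l : eq_wires k l = true -> k = l.
Proof.
  unfold eq_wires; destruct (strip k l) as [[|]|] eqn:E; try congruence.
  apply strip_app in E; now rewrite app_nil_r in E.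
Qed.

Fixpoint flatten (ars : list (list nat * list nat)) (e : expr) :
    option (list nat * list nat * list layer) :=
  match e with
  | EGen n =>
      match nth_error ars n with
      | Some (d, c) => Some (d, c, [Layer [] n d c []])
      | None => None
      end
  | EId w => Some (flat w, flat w, [])
  | EComp e e' =>
      match flatten ars e, flatten ars e' with
      | Some (d, c, l), Some (d', c', l') =>
          if eq_wires c' d then Some (d', c, l' ++ l) else None
      | _, _ => None
      end
  | ETens e e' =>
      match flatten ars e, flatten ars e' with
      | Some (d, c, l), Some (d', c', l') =>
          Some (d ++ d', c ++ c',
                map (whisker [] d') l ++ map (whisker c []) l')
      | _, _ => None
      end
  end.

Lemma flatten_sound ars e d c l :
  ars = map arity gens -> flatten ars e = Some (d, c, l) ->
  ev e = ev_layers d l /\ wf d l /\ target d l = c.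
Proof.
  intros ->; revert d c l.
  induction e as [n|w|e IH e' IH'|e IH e' IH']; intros d c l; simpl.
  - rewrite nth_error_map.
    destruct (nth_error gens n) as [g|] eqn:E; simpl; [|congruence].
    intros [= <- <- <-].
    assert (V : valid (Layer [] n (flat (gen_dom g)) (flat (gen_cod g)) [])).
    { unfold valid, mor_at; simpl; rewrite E, !ten_flat; apply gen_hom. }
    destruct (ev_layer_hom _ V) as [_ Vc].
    simpl; unfold ldom, lcod in *; simpl in *; rewrite app_nil_r in Vc.
    rewrite !app_nil_r; split; [|auto].
    rewrite <- Vc, comp_idl; unfold ev_layer; simpl.
    now rewrite tens_unitl, tens_unitr.
  - intros [= <- <- <-]; simpl; now rewrite ten_flat.
  - destruct (flatten (map arity gens) e) as [[[d1 c1] l1]|]; [|congruence].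
    destruct (flatten (map arity gens) e') as [[[d2 c2] l2]|]; [|congruence].
    destruct (eq_wires c2 d1) eqn:E; [|congruence].
    intros [= <- <- <-]; apply eq_wires_eq in E; subst d1.
    destruct (IH _ _ _ eq_refl) as (E1 & W1 & T1).
    destruct (IH' _ _ _ eq_refl) as (E2 & W2 & T2).
    subst c2 c1; destruct (ev_layers_app l2 l1 d2 W2 W1) as (E3 & W3 & T3).
    rewrite E1, E2, E3; auto.
  - destruct (flatten (map arity gens) e) as [[[d1 c1] l1]|]; [|congruence].
    destruct (flatten (map arity gens) e') as [[[d2 c2] l2]|]; [|congruence].
    intros [= <- <- <-].
    destruct (IH _ _ _ eq_refl) as (E1 & W1 & T1).
    destruct (IH' _ _ _ eq_refl) as (E2 & W2 & T2).
    destruct (whisker_layers [] d2 l1 d1 W1) as (E3 & W3 & T3).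
    destruct (whisker_layers c1 [] l2 d2 W2) as (E4 & W4 & T4).
    simpl in *; rewrite T1 in T3; rewrite app_nil_r in E4, W4, T4.
    rewrite <- T3 in E4, W4, T4.
    destruct (ev_layers_app _ _ _ W3 W4) as (E5 & W5 & T5).
    rewrite E5, T5, T4, T2, app_nil_r, T3; split; [|auto].
    rewrite T3 in E4; rewrite E1, E2, E3, E4, tens_unitl, tens_unitr.
    destruct (ev_layers_hom _ _ W1) as [_ C1], (ev_layers_hom _ _ W2) as [D2 _].
    rewrite <- tens_comp by (rewrite ?dom_id, ?cod_id; congruence).
    rewrite <- T1, <- C1, <- D2, comp_idl, comp_idr; reflexivity.
Qed.

Definition eq_layer (x y : layer) : bool :=
  Nat.eqb (gn x) (gn y) && eq_wires (pre x) (pre y) && eq_wires (gin x) (gin y)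
  && eq_wires (gout x) (gout y) && eq_wires (post x) (post y).

Fixpoint eq_layers (k l : list layer) : bool :=
  match k, l with
  | [], [] => true
  | x :: k, y :: l => eq_layer x y && eq_layers k l
  | _, _ => false
  end.

Lemma eq_layers_eq k l : eq_layers k l = true -> k = l.
Proof.
  revert l; induction k as [|x k IH]; intros [|y l]; simpl; try congruence.
  unfold eq_layer; rewrite !andb_true_iff, Nat.eqb_eq.
  intros (((((E1 & E2) & E3) & E4) & E5) & E6).
  rewrite (IH _ E6); apply eq_wires_eq in E2, E3, E4, E5.
  destruct x, y; simpl in *; congruence.
Qed.

Definition norm (l : list layer) : list layer :=
  normalize (length l * length l) l.

Definition same (ars : list (list nat * list nat)) (e e' : expr) : bool :=
  match flatten ars e, flatten ars e' with
  | Some (d, _, l), Some (d', _, l') =>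
      eq_wires d d' && eq_layers (norm l) (norm l')
  | _, _ => false
  end.

Theorem same_sound ars e e' :
  ars = map arity gens -> same ars e e' = true -> ev e = ev e'.
Proof.
  intros Ha; unfold same.
  destruct (flatten ars e) as [[[d c] l]|] eqn:E; [|congruence].
  destruct (flatten ars e') as [[[d' c'] l']|] eqn:E'; [|congruence].
  rewrite andb_true_iff; intros [Hd Hl].
  apply eq_wires_eq in Hd; apply eq_layers_eq in Hl; subst d'.
  destruct (flatten_sound _ _ _ _ _ Ha E) as (-> & W & _).
  destruct (flatten_sound _ _ _ _ _ Ha E') as (-> & W' & _).
  rewrite <- (normalize_sound (length l * length l) l _ W).
  unfold norm in Hl; rewrite Hl; now apply normalize_sound.
Qed.

Definition typed_as (ars : list (list nat * list nat)) (e : expr)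
    (v w : wires) : bool :=
  match flatten ars e with
  | Some (d, c, _) => eq_wires d (flat v) && eq_wires c (flat w)
  | None => false
  end.

Theorem typed_as_sound ars e v w :
  ars = map arity gens -> typed_as ars e v w = true ->
  ev e ⦂ ev_wires v ⟶ ev_wires w.
Proof.
  intros Ha; unfold typed_as.
  destruct (flatten ars e) as [[[d c] l]|] eqn:E; [|congruence].
  rewrite andb_true_iff; intros [Hd Hc].
  apply eq_wires_eq in Hd, Hc; subst d c.
  destruct (flatten_sound _ _ _ _ _ Ha E) as (-> & W & T).
  generalize (ev_layers_hom _ _ W); now rewrite T, !ten_flat.
Qed.

(** ** Finding a subdiagram *)

(** The search carries no proof: what it returns is compared with the original
    diagram by [same]. *)
Definition exchange_right (x y : layer) : option (layer * layer) :=
  match strip (pre x ++ gout x) (pre y) with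
  | Some mid =>
      match strip (mid ++ gin y ++ post y) (post x) with
      | Some [] =>
          Some (Layer (pre x ++ gin x ++ mid) (gn y) (gin y) (gout y) (post y),
                Layer (pre x) (gn x) (gin x) (gout x) (mid ++ gout y ++ post y))
      | _ => None
      end
  | None => None
  end.

Definition commute (x y : layer) : option (layer * layer) :=
  match exchange x y with Some p => Some p | None => exchange_right x y end.

(* The list [l] has its last layer first. *)
Fixpoint pull (l : list layer) (y : layer) : option (layer * list layer) :=
  match l with
  | [] => Some (y, [])
  | x :: l =>
      match commute x y with
      | Some (y', x') =>
          match pull l y' with
          | Some (y'', l') => Some (y'', x' :: l')
          | None => None
          end
      | None => None
      end
  end.

(** [P], [M] and [Q] are the layers before the match, in it and after it, last
    one first. A layer outside the match goes before it when it commutes with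
    all that has been gathered, and after it otherwise. *)
Fixpoint gather (L : list layer) (D P M Q : list layer) :
    list (list layer * list layer * list layer) :=
  match D with
  | [] => match L with [] => [(rev P, rev M, rev Q)] | _ => [] end
  | x :: D =>
      let skip :=
        match pull (Q ++ M) x with
        | Some (x', QM) =>
            gather L D (x' :: P) (skipn (length Q) QM) (firstn (length Q) QM)
        | None => gather L D P M (x :: Q)
        end in
      match L with
      | [] => skip
      | y :: L' =>
          if Nat.eqb (gn x) (gn y) then
            match pull Q x with
            | Some (x', Q') => gather L' D P (x' :: M) Q' ++ skip
            | None => skip
            end
          else skip
      end
  end.

Definition candidates (d : list nat) (L D : list layer) :
    list (list layer * (list nat * list nat) * list layer) :=
  flat_map (fun '(P, M, Q) =>
    match L, M with
    | l :: _, x :: _ =>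
        let a := firstn (length (pre x) - length (pre l)) (pre x) in
        let b := skipn (length a + length d) (ldom x) in
        if eq_wires (ldom x) (a ++ d ++ b)
           && eq_layers (norm M) (norm (map (whisker a b) L))
        then [(P, (a, b), Q)] else []
    | _, _ => []
    end) (gather L D [] [] []).

Definition wires_of (l : list nat) : wires :=
  match l with
  | [] => WUnit
  | n :: l => fold_left (fun w m => WTens w (WAtom m)) l (WAtom n)
  end.

Definition tens_wires (a : list nat) (e : expr) (b : list nat) : expr :=
  let e := match a with [] => e | _ => ETens (EId (wires_of a)) e end in
  match b with [] => e | _ => ETens e (EId (wires_of b)) end.

Definition expr_of_layer (x : layer) : expr :=
  tens_wires (pre x) (EGen (gn x)) (post x).

Definition expr_of (d : list nat) (l : list layer) : expr :=
  match l with
  | [] => EId (wires_of d)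
  | x :: l => fold_left (fun e y => EComp (expr_of_layer y) e) l (expr_of_layer x)
  end.

Definition readback (ars : list (list nat * list nat)) (e : expr) : expr :=
  match flatten ars e with
  | Some (d, _, l) => expr_of d (norm l)
  | None => e
  end.

Definition comp_layers (l : list layer) (e : expr) : expr :=
  match l with [] => e | x :: _ => EComp (expr_of [] l) e end.

(** The layers before a subdiagram, the wires on its left and on its right, and
    the layers after it. *)
Definition surrounding : Type :=
  list layer * (list nat * list nat) * list layer.

Definition plug (d : list nat) (c : surrounding) (h : expr) : expr :=
  let '(P, (a, b), Q) := c in
  comp_layers Q (match P with
                 | [] => tens_wires a h b
                 | _ => EComp (tens_wires a h b) (expr_of d P)
                 end).

Lemma plug_congr d c h h' : ev h = ev h' -> ev (plug d c h) = ev (plug d c h').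
Proof.
  intros E; destruct c as [[P [a b]] Q]; unfold plug, comp_layers, tens_wires.
  destruct P, Q, a, b; cbn; now rewrite E.
Qed.

Definition find (ars : list (list nat * list nat)) (k : nat) (e el : expr) :
    option (list nat * surrounding) :=
  match flatten ars e, flatten ars el with
  | Some (d, _, l), Some (dl, _, ll) =>
      match nth_error (candidates dl (norm ll) (norm l)) k with
      | Some c => Some (d, c)
      | None => None
      end
  | _, _ => None
  end.

Theorem rewrite_sound ars d c e el er e' :
  ars = map arity gens -> same ars e (plug d c el) = true ->
  same ars (plug d c er) e' = true -> ev el = ev er -> ev e = ev e'.
Proof.
  intros Ha H H' E.
  rewrite (same_sound _ _ _ Ha H), (plug_congr _ _ _ _ E).
  exact (same_sound _ _ _ Ha H').
Qed.

End Diagrams.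

(** ** The tactics *)

(** A class, so that the typing of every generator of a diagram is found by
    resolution. *)
Existing Class hom.

Ltac insert x l :=
  lazymatch l with
  | nil => constr:(cons x nil)
  | cons x _ => l
  | cons ?y ?t => let t' := insert x t in constr:(cons y t')
  end.

Ltac index x l :=
  lazymatch l with
  | cons x _ => constr:(O)
  | cons _ ?t => let n := index x t in constr:(S n)
  end.

Ltac objects o l :=
  lazymatch o with
  | ?A ⊠ ?B => let l := objects A l in objects B l
  | 𝟙 => l
  | _ => insert o l
  end.

Ltac morphisms f l :=
  lazymatch f with
  | ?g ∘ ?h => let l := morphisms g l in morphisms h l
  | ?g ⊗ ?h => let l := morphisms g l in morphisms h l
  | idm _ => l
  | _ => insert f l
  end.

(* Objects that occur only under an identity are not found through the typing
   of a generator. *)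
Ltac id_objects f l :=
  lazymatch f with
  | ?g ∘ ?h => let l := id_objects g l in id_objects h l
  | ?g ⊗ ?h => let l := id_objects g l in id_objects h l
  | idm ?A => objects A l
  | _ => l
  end.

Ltac hom_of f :=
  lazymatch constr:(ltac:(eexists; eexists; typeclasses eauto) :
             exists A B, hom A B f) with
  | ex_intro _ _ (ex_intro _ _ ?H) => H
  end.

Ltac homs fs :=
  lazymatch fs with
  | nil => constr:(tt)
  | cons ?f ?t =>
      let H := hom_of f in let r := homs t in constr:((H, r))
  end.

Ltac homs_objects hs l :=
  lazymatch hs with
  | tt => l
  | (?H, ?r) =>
      lazymatch type of H with
      | hom ?A ?B _ =>
          let l := objects A l in let l := objects B l in homs_objects r l
      end
  end.

Ltac quote_ob obs o :=
  lazymatch o with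
  | ?A ⊠ ?B =>
      let a := quote_ob obs A in let b := quote_ob obs B in constr:(WTens a b)
  | 𝟙 => constr:(WUnit)
  | _ => let n := index o obs in constr:(WAtom n)
  end.

Ltac quote_homs obs hs :=
  lazymatch hs with
  | tt => constr:(@nil (gen obs))
  | (?H, ?r) =>
      lazymatch type of H with
      | hom ?A ?B ?f =>
          let a := quote_ob obs A in let b := quote_ob obs B in
          let t := quote_homs obs r in
          constr:(cons (Gen obs f a b H) t)
      end
  end.

Ltac quote_mor obs fs f :=
  lazymatch f with
  | ?g ∘ ?h =>
      let a := quote_mor obs fs g in let b := quote_mor obs fs h in
      constr:(EComp a b)
  | ?g ⊗ ?h =>
      let a := quote_mor obs fs g in let b := quote_mor obs fs h in
      constr:(ETens a b)
  | idm ?A => let a := quote_ob obs A in constr:(EId a)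
  | _ => let n := index f fs in constr:(EGen n)
  end.

Ltac quoting f g h k :=
  let T := type of f in
  lazymatch T with
  | Mor ?C =>
      let fs := morphisms f (@nil T) in
      let fs := morphisms g fs in
      let fs := morphisms h fs in
      let hs := homs fs in
      let obs := homs_objects hs (@nil (Ob C)) in
      let obs := id_objects f obs in
      let obs := id_objects g obs in
      let obs := id_objects h obs in
      let gens := quote_homs obs hs in
      let ars := eval cbv [map arity flat app gen_dom gen_cod] in
        (map (arity obs) gens) in
      let e := quote_mor obs fs f in
      let e' := quote_mor obs fs g in
      let e'' := quote_mor obs fs h in
      k obs gens ars e e' e''
  end.

(** [smc] proves an equation that holds in every strict monoidal category. *)
Ltac smc :=
  lazymatch goal with
  | |- ?f = ?g =>
      quoting f g g ltac:(fun obs gens ars e e' _ =>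
        change (ev obs gens e = ev obs gens e');
        refine (same_sound obs gens ars e e' eq_refl _);
        vm_compute; reflexivity)
  end.

(** [hom] proves that a composite has the stated domain and codomain. *)
Ltac hom :=
  lazymatch goal with
  | |- ?f ⦂ ?A ⟶ ?B =>
      quoting f (idm A) (idm B) ltac:(fun obs gens ars e a b =>
        lazymatch a with EId ?v => lazymatch b with EId ?w =>
          change (ev obs gens e ⦂ ev_wires obs v ⟶ ev_wires obs w);
          refine (typed_as_sound obs gens ars e v w eq_refl _);
          vm_compute; reflexivity
        end end)
  end.

Ltac diagram_rewrite k H :=
  lazymatch goal with
  | |- ?f = ?g =>
      let T := type of H in
      lazymatch eval hnf in T with
      | ?l = ?r =>
          quoting f l r ltac:(fun obs gens ars e el er =>
            let p := eval vm_compute in (find ars k e el) in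
            lazymatch p with
            | Some (?d, ?c) =>
                let e' := eval vm_compute in (readback ars (plug d c er)) in
                let f' :=
                  eval cbv [ev mor_at nth_error gen_mor ev_wires ob_at nth] in
                  (ev obs gens e') in
                transitivity f';
                [ refine (rewrite_sound obs gens ars d c e el er e'
                            eq_refl _ _ H); vm_compute; reflexivity |]
            | None => fail "no such subdiagram"
            end)
      end
  end.

(** [drw H] rewrites with [H] in the left side of the goal, at the first
    occurrence of the left side of [H] as a subdiagram, or at the one that
    has [k] others before it for [drw H at k]. *)
Tactic Notation "drw" constr(H) := diagram_rewrite 0 H.
Tactic Notation "drw" constr(H) "at" constr(k) := diagram_rewrite k H.
Tactic Notation "drw" "<-" constr(H) :=
  diagram_rewrite 0 constr:(eq_sym H).
Tactic Notation "drw" "<-" constr(H) "at" constr(k) :=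
  diagram_rewrite k constr:(eq_sym H).

(** * Duality *)

(** Composition and tensor product are both reversed. This exchanges algebras
    with coalgebras while B1 ⊗ B2 keeps its shape once the roles of B1 and B2
    are swapped, so every statement on the multiplicative half of a cross
    product yields its comultiplicative counterpart. *)
Definition dual_category (C : category) : category.
Proof.
  refine (@Category (Ob C) (Mor C) cod dom idm (fun g f => f ∘ g)
    _ _ _ _ _ _ _).
  - exact (@cod_id C).
  - exact (@dom_id C).
  - intros g f H; now apply cod_comp.
  - intros g f H; now apply dom_comp.
  - exact (@comp_idr C).
  - exact (@comp_idl C).
  - intros h g f H H'; symmetry; now apply comp_assoc.
Defined.

Definition dual_monoidal (C : strict_monoidal_category) :
  strict_monoidal_category.
Proof.
  refine (@StrictMonoidalCategory (dual_category C)
    (fun X Y : Ob C => Y ⊠ X) (𝟙 : Ob C) (fun f g : Mor C => g ⊗ f)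
    _ _ _ _ _ _ _ _ _ _).
  - intros f g; apply cod_tens.
  - intros f g; apply dom_tens.
  - intros A B; apply tens_id.
  - intros g f g' f' H H'; now apply tens_comp.
  - intros X Y Z; symmetry; apply tens_ob_assoc.
  - exact (@tens_ob_unitr C).
  - exact (@tens_ob_unitl C).
  - intros f g h; symmetry; apply tens_assoc.
  - exact (@tens_unitr C).
  - exact (@tens_unitl C).
Defined.

(** The braiding stays the same morphism: its source and its target are both
    swapped and reversed. *)
Definition dual (C : strict_braided_category) : strict_braided_category.
Proof.
  refine (@StrictBraidedCategory (dual_monoidal C) (fun X Y => braid X Y : Mor C)
    _ _ _ _ _).
  - intros X Y; destruct (braid_hom X Y); now split.
  - intros X Y; destruct (braid_iso X Y) as (g & [] & [] & H & H').
    exists g; now repeat split.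
  - intros f g; symmetry; apply (@braid_natural C f g).
  - intros X Y Z; apply (@braid_tensl C).
  - intros X Y Z; apply (@braid_tensr C).
Defined.

(** * Algebras, coalgebras and bialgebras *)

Existing Class is_algebra.
Existing Class is_coalgebra.
Existing Class is_bialgebra.

#[export] Existing Instances braid_hom alg_mul_hom alg_unit_hom
  coalg_comul_hom coalg_counit_hom bialg_algebra bialg_coalgebra.

Section Braiding.

Context {C : strict_braided_category}.

Lemma invertible_idempotent (Y : Ob C) e g :
  mutually_inverse Y Y e g -> e = e ∘ e -> e = idm Y.
Proof.
  intros (He & Hg & Hge & _) H.
  assert (K : g ∘ (e ∘ e) = e) by (drw Hge; smc).
  now rewrite <- H, Hge in K.
Qed.

(** The hexagon for 𝟙 ⊗ 𝟙 = 𝟙 makes the braiding with the unit an idempotent. *)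
Lemma braid_unitl (Y : Ob C) : Ψ 𝟙 Y = idm Y.
Proof.
  destruct (braid_iso 𝟙 Y) as (g & H).
  rewrite tens_ob_unitl, tens_ob_unitr in H.
  apply (invertible_idempotent _ _ _ H).
  pose proof (@braid_tensl C 𝟙 𝟙 Y) as K.
  now rewrite tens_ob_unitl, tens_unitl, tens_unitr in K.
Qed.

Lemma braid_unitr (Y : Ob C) : Ψ Y 𝟙 = idm Y.
Proof.
  destruct (braid_iso Y 𝟙) as (g & H).
  rewrite tens_ob_unitl, tens_ob_unitr in H.
  apply (invertible_idempotent _ _ _ H).
  pose proof (@braid_tensr C Y 𝟙 𝟙) as K.
  now rewrite tens_ob_unitl, tens_unitl, tens_unitr in K.
Qed.

Context (X X' Y : Ob C) (f : Mor C).

Lemma braid_natl (hf : f ⦂ X ⟶ X') :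
  Ψ X' Y ∘ (f ⊗ idm Y) = (idm Y ⊗ f) ∘ Ψ X Y.
Proof.
  destruct hf as [<- <-]; pose proof (@braid_natural C f (idm Y)) as H.
  now rewrite dom_id, cod_id in H.
Qed.

Lemma braid_natr (hf : f ⦂ X ⟶ X') :
  Ψ Y X' ∘ (idm Y ⊗ f) = (f ⊗ idm Y) ∘ Ψ Y X.
Proof.
  destruct hf as [<- <-]; pose proof (@braid_natural C (idm Y) f) as H.
  now rewrite dom_id, cod_id in H.
Qed.

End Braiding.

Section BraidingUnit.

Context {C : strict_braided_category} (X Y : Ob C) (f : Mor C).

Lemma braid_forml (hf : f ⦂ X ⟶ 𝟙) : (idm Y ⊗ f) ∘ Ψ X Y = f ⊗ idm Y.
Proof.
  rewrite <- (braid_natl _ _ _ _ hf), braid_unitl.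
  smc.
Qed.

Lemma braid_formr (hf : f ⦂ X ⟶ 𝟙) : (f ⊗ idm Y) ∘ Ψ Y X = idm Y ⊗ f.
Proof.
  rewrite <- (braid_natr _ _ _ _ hf), braid_unitr.
  smc.
Qed.

End BraidingUnit.

Section Duals.

Context {C : strict_braided_category}.

Definition dual_bialgebra (B : bialgebra_data C) : bialgebra_data (dual C) :=
  @BialgebraData (dual C) (carrier B) (comul B) (eps B) (mul B) (eta B).

Lemma dual_hom (X Y : Ob C) (f : Mor C) :
  f ⦂ X ⟶ Y -> @hom (dual C) Y X f.
Proof. intros []; now split. Qed.

Lemma dual_coalgebra (A : Ob C) Δ ε :
  is_coalgebra A Δ ε -> @is_algebra (dual C) A Δ ε.
Proof.
  intros H; split; try apply dual_hom; try apply H; simpl.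
  symmetry; apply H.
Qed.

Lemma dual_algebra (A : Ob C) m η :
  is_algebra A m η -> @is_coalgebra (dual C) A m η.
Proof.
  intros H; split; try apply dual_hom; try apply H; simpl.
  symmetry; apply H.
Qed.

Lemma dual_is_bialgebra (B : bialgebra_data C) :
  is_bialgebra B -> is_bialgebra (dual_bialgebra B).
Proof.
  intros H; split; simpl.
  - apply dual_coalgebra; exact _.
  - apply dual_algebra; exact _.
  - rewrite (bialg_comul_mul H). smc.
  - apply (bialg_eps_mul H).
  - apply (bialg_comul_eta H).
  - apply (bialg_eps_eta H).
Qed.

Lemma dual_coalgebra_morphism (A : Ob C) ΔA εA (B : Ob C) ΔB εB f :
  coalgebra_morphism A ΔA εA B ΔB εB f ->
  @algebra_morphism (dual C) B ΔB εB A ΔA εA f.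
Proof. intros []; split; [now apply dual_hom|assumption..]. Qed.

Lemma dual_algebra_morphism (A : Ob C) mA ηA (B : Ob C) mB ηB f :
  algebra_morphism A mA ηA B mB ηB f ->
  @coalgebra_morphism (dual C) B mB ηB A mA ηA f.
Proof. intros []; split; [now apply dual_hom|assumption..]. Qed.

End Duals.

Set Implicit Arguments.
Unset Strict Implicit.
Unset Printing Implicit Defensive.

(** * Factorizations of a bialgebra *)

(** Data for which every element of [B] is uniquely a product of one of [B1] and
    one of [B2], with the coordinates given by (p1 ⊗ p2) Δ. The notion is
    self-dual under the exchange of [B1] and [B2]. *)
Record factorization {C : strict_braided_category} (B : bialgebra_data C)
    (B1 : Ob C) (m1 η1 : Mor C) (B2 : Ob C) (Δ2 ε2 i1 p1 i2 p2 : Mor C) :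
    Prop := Factorization {
  fact_algebra : is_algebra B1 m1 η1;
  fact_coalgebra : is_coalgebra B2 Δ2 ε2;
  fact_i1 : algebra_morphism B1 m1 η1 B (mul B) (eta B) i1;
  fact_p2 : coalgebra_morphism B (comul B) (eps B) B2 Δ2 ε2 p2;
  fact_p1_hom : p1 ⦂ B ⟶ B1;
  fact_i2_hom : i2 ⦂ B2 ⟶ B;
  fact_p1_i1 : p1 ∘ i1 = idm B1;
  fact_p2_i2 : p2 ∘ i2 = idm B2;
  fact_comul_mul : (p1 ⊗ p2) ∘ comul B ∘ (mul B ∘ (i1 ⊗ i2)) = idm (B1 ⊠ B2);
  fact_mul_comul : mul B ∘ (i1 ⊗ i2) ∘ ((p1 ⊗ p2) ∘ comul B) = idm B
}.

Existing Class factorization.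

Lemma dual_factorization {C : strict_braided_category} (B : bialgebra_data C)
    (B1 : Ob C) (m1 η1 : Mor C) (B2 : Ob C) (Δ2 ε2 i1 p1 i2 p2 : Mor C) :
  is_bialgebra B ->
  factorization B B1 m1 η1 B2 Δ2 ε2 i1 p1 i2 p2 ->
  @factorization (dual C) (dual_bialgebra B) B2 Δ2 ε2 B1 m1 η1 p2 i2 p1 i1.
Proof.
  intros HB [H1 H2 H3 H4 H5 H6 H7 H8 H9 H10].
  pose proof (alg_mor_hom H3); pose proof (coalg_mor_hom H4).
  split; simpl.
  - now apply dual_coalgebra.
  - now apply dual_algebra.
  - now apply dual_coalgebra_morphism.
  - now apply dual_algebra_morphism.
  - now apply dual_hom.
  - now apply dual_hom.
  - assumption.
  - assumption.
  - rewrite <- H9; smc.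
  - rewrite <- H10; smc.
Qed.

(** Proves an equation from [H], the same one in the dual category, where
    composites and tensor products associate the other way. *)
Ltac by_dual H :=
  let K := fresh in
  pose proof H as K; simpl in K; refine (eq_trans _ (eq_trans K _)); smc.

Section FactorizationMultiplication.

Context {C : strict_braided_category} {B : bialgebra_data C}
  {hB : is_bialgebra B} {B1 : Ob C} {m1 η1 : Mor C} {B2 : Ob C}
  {Δ2 ε2 i1 p1 i2 p2 : Mor C}
  (hF : factorization B B1 m1 η1 B2 Δ2 ε2 i1 p1 i2 p2).

Local Notation m := (mul B).
Local Notation η := (eta B).
Local Notation Δ := (comul B).
Local Notation ε := (eps B).

Lemma fact_hom_i1 : i1 ⦂ B1 ⟶ B. Proof. apply (fact_i1 hF). Qed.
Lemma fact_hom_p2 : p2 ⦂ B ⟶ B2. Proof. apply (fact_p2 hF). Qed.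
#[local] Existing Instances fact_algebra fact_coalgebra fact_p1_hom fact_i2_hom
   fact_hom_i1 fact_hom_p2.

Let GF := fact_comul_mul hF.
Let FG := fact_mul_comul hF.

Lemma p1_eta : p1 ∘ η = η1.
Proof.
  rewrite <- (alg_mor_unit (fact_i1 hF)). drw (fact_p1_i1 hF). smc.
Qed.

(** As Δη = η ⊗ η, the factors of the unit are i1 p1 η = η and i2 p2 η. *)
Lemma i2_p2_eta : i2 ∘ p2 ∘ η = η.
Proof.
  transitivity (m ∘ (i1 ⊗ i2) ∘ ((p1 ⊗ p2) ∘ Δ) ∘ η).
  - symmetry. drw (bialg_comul_eta hB). drw p1_eta.
    drw (alg_mor_unit (fact_i1 hF)). drw (alg_unitl (bialg_algebra hB)). smc.
  - drw FG. smc.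
Qed.

Lemma p1_mul_i1_i2 : p1 ∘ m ∘ (i1 ⊗ i2) = idm B1 ⊗ ε2.
Proof.
  transitivity ((idm B1 ⊗ ε2) ∘ ((p1 ⊗ p2) ∘ Δ ∘ (m ∘ (i1 ⊗ i2)))).
  - symmetry. drw (coalg_mor_counit (fact_p2 hF)).
    drw (coalg_counitr (bialg_coalgebra hB)). smc.
  - drw GF. smc.
Qed.

(** [p1] is left [B1]-linear: if b = b1 b2 then a b = (a b1) b2 with a b1 in
    [B1], and p1 kills the second factor. *)
Lemma p1_mul_i1 : p1 ∘ m ∘ (i1 ⊗ idm B) = m1 ∘ (idm B1 ⊗ p1).
Proof.
  transitivity (p1 ∘ m ∘ (i1 ⊗ (m ∘ (i1 ⊗ i2) ∘ ((p1 ⊗ p2) ∘ Δ)))).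
  - symmetry. drw FG. smc.
  - drw <- (alg_assoc (bialg_algebra hB)).
    drw <- (alg_mor_mul (fact_i1 hF)). drw p1_mul_i1_i2.
    drw (coalg_mor_counit (fact_p2 hF)).
    drw (coalg_counitr (bialg_coalgebra hB)). smc.
Qed.

Lemma p1_i2 : p1 ∘ i2 = η1 ∘ ε2.
Proof.
  transitivity (p1 ∘ m ∘ (i1 ⊗ i2) ∘ (η1 ⊗ idm B2)).
  - symmetry. drw (alg_mor_unit (fact_i1 hF)).
    drw (alg_unitl (bialg_algebra hB)). smc.
  - drw p1_mul_i1_i2. smc.
Qed.

End FactorizationMultiplication.

#[export] Existing Instances fact_algebra fact_coalgebra fact_p1_hom fact_i2_hom
   fact_hom_i1 fact_hom_p2.

Section FactorizationCounit.

Context {C : strict_braided_category} {B : bialgebra_data C}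
  {hB : is_bialgebra B} {B1 : Ob C} {m1 η1 : Mor C} {B2 : Ob C}
  {Δ2 ε2 i1 p1 i2 p2 : Mor C}
  (hF : factorization B B1 m1 η1 B2 Δ2 ε2 i1 p1 i2 p2).

Local Notation m := (mul B).
Local Notation η := (eta B).
Local Notation Δ := (comul B).
Local Notation ε := (eps B).

Let hB' := dual_is_bialgebra _ hB.
Let hF' := dual_factorization hB hF.
Let GF := fact_comul_mul hF.
Let FG := fact_mul_comul hF.

Lemma eps_i1_p1 : ε ∘ i1 ∘ p1 = ε.
Proof. by_dual (i2_p2_eta (hB := hB') hF'). Qed.

Lemma p2_mul_i1_i2 : p2 ∘ m ∘ (i1 ⊗ i2) = (ε ∘ i1) ⊗ idm B2.
Proof.
  transitivity (((ε ∘ i1) ⊗ idm B2) ∘ ((p1 ⊗ p2) ∘ Δ ∘ (m ∘ (i1 ⊗ i2)))).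
  - symmetry. drw eps_i1_p1.
    drw (coalg_counitl (bialg_coalgebra hB)). smc.
  - drw GF. smc.
Qed.

(** By the same decomposition of b, p2 (a b) = ε(a) p2 b for a in [B1]. *)
Lemma p2_mul_i1 : p2 ∘ m ∘ (i1 ⊗ idm B) = (ε ∘ i1) ⊗ p2.
Proof.
  transitivity (p2 ∘ m ∘ (i1 ⊗ (m ∘ (i1 ⊗ i2) ∘ ((p1 ⊗ p2) ∘ Δ)))).
  - symmetry. drw FG. smc.
  - drw <- (alg_assoc (bialg_algebra hB)).
    drw <- (alg_mor_mul (fact_i1 hF)). drw p2_mul_i1_i2.
    drw (alg_mor_mul (fact_i1 hF)). drw (bialg_eps_mul hB).
    drw eps_i1_p1. drw (coalg_counitl (bialg_coalgebra hB)). smc.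
Qed.

(** [p2] identifies [B2] with the quotient of [B] by the right ideal generated
    by the augmentation ideal of [B1]: for b = b1 b2 both sides are
    ε(b1) p2 (b2 c). *)
Lemma p2_mul_i2_p2 : p2 ∘ m ∘ ((i2 ∘ p2) ⊗ idm B) = p2 ∘ m.
Proof.
  symmetry.
  transitivity (p2 ∘ m ∘ ((m ∘ (i1 ⊗ i2) ∘ ((p1 ⊗ p2) ∘ Δ)) ⊗ idm B)).
  - symmetry. drw FG. smc.
  - drw (alg_assoc (bialg_algebra hB)). drw p2_mul_i1. drw eps_i1_p1.
    drw (coalg_counitl (bialg_coalgebra hB)). smc.
Qed.

Lemma p2_i1 : p2 ∘ i1 = p2 ∘ η ∘ ε ∘ i1.
Proof.
  transitivity (p2 ∘ m ∘ (i1 ⊗ η)).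
  - symmetry. drw (alg_unitr (bialg_algebra hB)). smc.
  - drw p2_mul_i1. smc.
Qed.

End FactorizationCounit.

Section FactorizationComultiplication.

Context {C : strict_braided_category} {B : bialgebra_data C}
  {hB : is_bialgebra B} {B1 : Ob C} {m1 η1 : Mor C} {B2 : Ob C}
  {Δ2 ε2 i1 p1 i2 p2 : Mor C}
  (hF : factorization B B1 m1 η1 B2 Δ2 ε2 i1 p1 i2 p2).

Local Notation m := (mul B).
Local Notation η := (eta B).
Local Notation Δ := (comul B).
Local Notation ε := (eps B).

Let hB' := dual_is_bialgebra _ hB.
Let hF' := dual_factorization hB hF.
Let FG := fact_mul_comul hF.

Lemma eps_i2 : ε ∘ i2 = ε2.
Proof. by_dual (p1_eta hF'). Qed.

Lemma factorization_iso :
  mutually_inverse B (B1 ⊠ B2) ((p1 ⊗ p2) ∘ Δ) (m ∘ (i1 ⊗ i2)).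
Proof.
  split; [hom|split; [hom|split]].
  - exact FG.
  - exact (fact_comul_mul hF).
Qed.

Lemma comul_p2_i2 : (idm B ⊗ p2) ∘ Δ ∘ i2 = (i2 ⊗ idm B2) ∘ Δ2.
Proof. by_dual (p1_mul_i1 (hB := hB') hF'). Qed.

(** [B1] is a left coideal: its comultiplication has its right leg in [B1]. *)
Lemma comul_p1_i1 : (idm B ⊗ (i1 ∘ p1)) ∘ Δ ∘ i1 = Δ ∘ i1.
Proof. by_dual (p2_mul_i2_p2 (hB := hB') hF'). Qed.

(** For a in [B1], the leg a'' is again in [B1], so p2 (a'' b'') is
    ε(a'') p2 b''. *)
Lemma comul_p2_mul_i1 :
  (idm B ⊗ p2) ∘ Δ ∘ m ∘ (i1 ⊗ idm B) = (m ⊗ p2) ∘ (i1 ⊗ Δ).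
Proof.
  drw (bialg_comul_mul hB). drw <- comul_p1_i1.
  drw (braid_natl _ _ B _ (fact_hom_i1 hF)).
  drw (p2_mul_i1 hF).
  assert (He : ε ∘ i1 ⦂ B1 ⟶ 𝟙) by hom.
  drw (braid_forml _ B _ He). drw (eps_i1_p1 hF).
  drw (coalg_counitr (bialg_coalgebra hB)). smc.
Qed.

End FactorizationComultiplication.

(** * The projection relations in terms of the factors *)

(** A relation between two strands still holds when a third strand [W] passes
    between them: [W] is moved to the other side of [f] by naturality, and back
    by the inverse braiding. *)
Lemma relation_across_braid {C : strict_braided_category} (U V W X Y Z : Ob C)
    (f h h' : Mor C) :
  f ⦂ X ⟶ Y ⊠ Z -> h ⦂ U ⊠ Y ⟶ V -> h' ⦂ U ⊠ Y ⟶ V ->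
  (h ⊗ idm Z) ∘ (idm U ⊗ f) = (h' ⊗ idm Z) ∘ (idm U ⊗ f) ->
  (h ⊗ idm (W ⊠ Z)) ∘ (idm U ⊗ Ψ W Y ⊗ idm Z) ∘ (idm (U ⊠ W) ⊗ f) =
  (h' ⊗ idm (W ⊠ Z)) ∘ (idm U ⊗ Ψ W Y ⊗ idm Z) ∘ (idm (U ⊠ W) ⊗ f).
Proof.
  intros Hf Hh Hh' E.
  destruct (braid_iso W Z) as (g & _ & Hg & Hgl & _).
  assert (S : (Ψ W Y ⊗ idm Z) ∘ (idm W ⊗ f) =
              (idm Y ⊗ g) ∘ (f ⊗ idm W) ∘ Ψ W X).
  { symmetry. drw <- (braid_natr _ _ W _ Hf).
    rewrite braid_tensr. drw Hgl. smc. }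
  drw S. drw E. symmetry. drw S. smc.
Qed.

(** The relation (δ) with its idempotent split: in Sweedler notation,
    p (u a') ⊗ a'' = p (u i(p a')) ⊗ a'' for u in [B]. *)
Definition absorbs {C : strict_braided_category} (B : bialgebra_data C)
    (i p : Mor C) : Prop :=
  ((p ∘ mul B) ⊗ idm B) ∘ (idm B ⊗ (comul B ∘ i)) =
  ((p ∘ mul B ∘ (idm B ⊗ (i ∘ p))) ⊗ idm B) ∘ (idm B ⊗ (comul B ∘ i)).

(** The relation between μl and Δ1 of a cocycle cross product, with every
    structure morphism replaced by the composite that restricts or projects the
    structure of [B]: μl = p1 m (i2 ⊗ i1), Δ1 = (p1 ⊗ p1) Δ i1,
    σ = p1 m (i2 ⊗ i2), νl = (p2 ⊗ p1) Δ i1 and φ21 = (p1 ⊗ p2) Δ m (i2 ⊗ i1). *)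
Definition mul_comul_relation {C : strict_braided_category}
    (B : bialgebra_data C) (B1 : Ob C) (m1 : Mor C) (B2 : Ob C)
    (i1 p1 i2 p2 : Mor C) : Prop :=
  ((p1 ∘ (mul B ∘ (i2 ⊗ i1))) ⊗ idm B1)
    ∘ (idm B2 ⊗ ((p1 ⊗ p1) ∘ comul B ∘ i1)) =
  ((m1 ∘ (idm B1 ⊗ (p1 ∘ (mul B ∘ (i2 ⊗ i2))))) ⊗ idm B1)
    ∘ (((p1 ⊗ p2) ∘ comul B ∘ (mul B ∘ (i2 ⊗ i1)))
         ⊗ ((p2 ⊗ p1) ∘ comul B ∘ i1))
    ∘ (idm B2 ⊗ ((p1 ⊗ p1) ∘ comul B ∘ i1)).

(** This says that s y = i1 p1 (s' i2(p2 y')) · i2 p2 (s'' y'') for s in [B] and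
    y in [B2]; (γ2) is this equation for the factors of x b = (x b1) b2. *)
Definition twists {C : strict_braided_category} (B : bialgebra_data C)
    (p1 i2 p2 : Mor C) : Prop :=
  (p1 ⊗ p2) ∘ comul B ∘ mul B ∘ (idm B ⊗ i2) =
  ((p1 ∘ mul B ∘ (idm B ⊗ (i2 ∘ p2))) ⊗ (p2 ∘ mul B))
    ∘ (idm B ⊗ Ψ B B ⊗ idm B) ∘ (comul B ⊗ (comul B ∘ i2)).

(** The expression of the hatted σ through σ, m2, μr and νr, and below that of
    φ21 through μl and μr, under the same replacement. *)
Definition sigma_relation {C : strict_braided_category}
    (B : bialgebra_data C) (B1 B2 : Ob C) (Δ2 i1 p1 i2 p2 : Mor C) : Prop :=
  (p1 ⊗ p2) ∘ comul B ∘ (mul B ∘ (i2 ⊗ i2)) =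
  ((p1 ∘ (mul B ∘ (i2 ⊗ i2)))
     ⊗ ((p2 ∘ (mul B ∘ (i2 ⊗ i2))) ∘ ((p2 ∘ (mul B ∘ (i2 ⊗ i1))) ⊗ idm B2)))
  ∘ (idm B2 ⊗ Ψ B2 B2 ⊗ idm (B1 ⊠ B2))
  ∘ (Δ2 ⊗ ((((p2 ⊗ p1) ∘ comul B ∘ i2) ⊗ idm B2) ∘ Δ2)).

Definition phi_relation {C : strict_braided_category}
    (B : bialgebra_data C) (B1 B2 : Ob C) (Δ2 i1 p1 i2 p2 : Mor C) : Prop :=
  (p1 ⊗ p2) ∘ comul B ∘ (mul B ∘ (i2 ⊗ i1)) =
  ((p1 ∘ (mul B ∘ (i2 ⊗ i1))) ⊗ (p2 ∘ (mul B ∘ (i2 ⊗ i1))))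
    ∘ (idm B2 ⊗ Ψ B2 B1 ⊗ idm B1) ∘ (Δ2 ⊗ ((p1 ⊗ p1) ∘ comul B ∘ i1)).

Definition gamma2_relation {C : strict_braided_category}
    (B : bialgebra_data C) (Π1 Π2 : Mor C) : Prop :=
  mul B ∘ (Π2 ⊗ idm B) =
    mul B ∘ (Π1 ⊗ Π2) ∘ gamma B Π2 ∘ delta B Π2 Π1 Π2.

Section Relations.

Context {C : strict_braided_category} {B : bialgebra_data C}
  {hB : is_bialgebra B} {B1 : Ob C} {m1 η1 : Mor C} {B2 : Ob C}
  {Δ2 ε2 i1 p1 i2 p2 : Mor C}
  (hF : factorization B B1 m1 η1 B2 Δ2 ε2 i1 p1 i2 p2).

Local Notation m := (mul B).
Local Notation Δ := (comul B).

Let FG := fact_mul_comul hF.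
Let GF := fact_comul_mul hF.
Let assoc := alg_assoc (bialg_algebra hB).
Let coassoc := coalg_coassoc (bialg_coalgebra hB).

Lemma delta_relation_iff_absorbs :
  delta_relation B (i1 ∘ p1) <-> absorbs B i1 p1.
Proof.
  unfold delta_relation, delta, absorbs; split; intros H.
  - transitivity ((p1 ⊗ idm B) ∘
      ((i1 ∘ p1) ⊗ idm B
        ∘ (m ⊗ idm B ∘ (idm B ⊗ idm B ⊗ idm B) ∘ (idm B ⊗ Δ))
        ∘ (idm B ⊗ (i1 ∘ p1))) ∘ (idm B ⊗ i1)).
    + symmetry. drw (fact_p1_i1 hF). drw (fact_p1_i1 hF). smc.
    + rewrite H. drw (fact_p1_i1 hF). drw (fact_p1_i1 hF). smc.
  - transitivity ((i1 ⊗ idm B) ∘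
      (((p1 ∘ m) ⊗ idm B) ∘ (idm B ⊗ (Δ ∘ i1))) ∘ (idm B ⊗ p1)); [smc|].
    rewrite H; smc.
Qed.

(** Both legs of Δ (x a) = Δ x Δ a may be projected. For the right legs this is
    the module property of [p2] and the coideal property of [B1], for the left
    leg of a it is (δ1), applied although the strand of x'' lies in between. *)
Lemma phi_relation_of_absorbs :
  absorbs B i1 p1 -> phi_relation B B1 B2 Δ2 i1 p1 i2 p2.
Proof.
  intros H; unfold phi_relation, absorbs in *.
  drw (bialg_comul_mul hB).
  assert (HD : Δ ∘ i1 ⦂ B1 ⟶ B ⊠ B) by hom.
  assert (Hl : p1 ∘ m ⦂ B ⊠ B ⟶ B1) by hom.
  assert (Hr : p1 ∘ m ∘ (idm B ⊗ (i1 ∘ p1)) ⦂ B ⊠ B ⟶ B1) by hom.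
  drw (relation_across_braid B HD Hl Hr H).
  drw <- (p2_mul_i2_p2 hF).
  drw <- (braid_natl _ _ B _ (fact_hom_p2 hF)).
  drw (comul_p2_i2 hF).
  drw <- (comul_p1_i1 hF).
  drw <- (braid_natr _ _ B2 _ (fact_p1_hom hF)).
  smc.
Qed.

(** The σ on the right side recombines the second factor of x i1(p1 a') with the
    first factor of a'', and the product of all factors is x a'. *)
Lemma sigma_nu_formula :
  ((m1 ∘ (idm B1 ⊗ (p1 ∘ (m ∘ (i2 ⊗ i2))))) ⊗ idm B1)
    ∘ (((p1 ⊗ p2) ∘ Δ ∘ (m ∘ (i2 ⊗ i1))) ⊗ ((p2 ⊗ p1) ∘ Δ ∘ i1))
    ∘ (idm B2 ⊗ ((p1 ⊗ p1) ∘ Δ ∘ i1)) =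
  ((p1 ∘ m) ⊗ p1) ∘ (i2 ⊗ (Δ ∘ i1)).
Proof.
  drw <- (p1_mul_i1 hF).
  drw <- assoc. drw FG. drw (comul_p1_i1 hF).
  drw <- coassoc. drw assoc. drw FG. smc.
Qed.

Lemma mul_comul_relation_of_absorbs :
  absorbs B i1 p1 -> mul_comul_relation B B1 m1 B2 i1 p1 i2 p2.
Proof.
  intros H; unfold mul_comul_relation.
  rewrite sigma_nu_formula. symmetry. drw H. smc.
Qed.

(** The relation gives (δ1) for u in [B2]; it extends to u = u1 u2 because [p1]
    is left [B1]-linear. *)
Lemma absorbs_of_mul_comul_relation :
  mul_comul_relation B B1 m1 B2 i1 p1 i2 p2 -> absorbs B i1 p1.
Proof.
  unfold mul_comul_relation, absorbs; rewrite sigma_nu_formula; intros H.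
  drw <- (comul_p1_i1 hF).
  transitivity (((p1 ∘ m) ⊗ (i1 ∘ p1)) ∘
    ((m ∘ (i1 ⊗ i2) ∘ ((p1 ⊗ p2) ∘ Δ)) ⊗ (Δ ∘ i1))).
  - symmetry. drw FG. smc.
  - drw assoc. drw (p1_mul_i1 hF). drw <- H.
    drw <- (p1_mul_i1 hF). drw <- assoc. drw FG. drw (comul_p1_i1 hF). smc.
Qed.

(** The factors of y, separated by νr and multiplied again after μr, recombine
    to y''. *)
Lemma sigma_formula :
  ((p1 ∘ (m ∘ (i2 ⊗ i2)))
     ⊗ ((p2 ∘ (m ∘ (i2 ⊗ i2))) ∘ ((p2 ∘ (m ∘ (i2 ⊗ i1))) ⊗ idm B2)))
  ∘ (idm B2 ⊗ Ψ B2 B2 ⊗ idm (B1 ⊠ B2))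
  ∘ (Δ2 ⊗ ((((p2 ⊗ p1) ∘ Δ ∘ i2) ⊗ idm B2) ∘ Δ2)) =
  ((p1 ∘ m ∘ (idm B ⊗ (i2 ∘ p2))) ⊗ (p2 ∘ m))
    ∘ (idm B ⊗ Ψ B B ⊗ idm B) ∘ ((Δ ∘ i2) ⊗ (Δ ∘ i2)).
Proof.
  drw (p2_mul_i2_p2 hF). drw <- (comul_p2_i2 hF) at 1.
  drw coassoc. drw assoc. drw FG.
  drw <- (comul_p2_i2 hF).
  drw (braid_natl _ _ B2 _ (fact_hom_p2 hF)). drw (p2_mul_i2_p2 hF).
  drw (braid_natr _ _ B _ (fact_hom_p2 hF)). smc.
Qed.

Lemma sigma_relation_of_twists :
  twists B p1 i2 p2 -> sigma_relation B B1 B2 Δ2 i1 p1 i2 p2.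
Proof.
  intros H; unfold sigma_relation; rewrite sigma_formula.
  transitivity ((p1 ⊗ p2) ∘ Δ ∘ m ∘ (idm B ⊗ i2) ∘ (i2 ⊗ idm B2)); [smc|].
  rewrite H; smc.
Qed.

(** Both sides are left [B1]-linear in s, so it suffices to take s in [B2]. *)
Lemma twists_of_sigma_relation :
  sigma_relation B B1 B2 Δ2 i1 p1 i2 p2 -> twists B p1 i2 p2.
Proof.
  unfold sigma_relation, twists; rewrite sigma_formula; intros H.
  assert (R : (p1 ⊗ p2) ∘ Δ ∘ m ∘ (i1 ⊗ idm B) =
              (m1 ⊗ idm B2) ∘ (idm B1 ⊗ ((p1 ⊗ p2) ∘ Δ))).
  { drw (comul_p2_mul_i1 hF). drw (p1_mul_i1 hF). smc. }
  transitivity ((p1 ⊗ p2) ∘ Δ ∘ m ∘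
    ((m ∘ (i1 ⊗ i2) ∘ ((p1 ⊗ p2) ∘ Δ)) ⊗ i2)).
  - symmetry. drw FG. smc.
  - drw assoc. drw R. drw H. symmetry.
    (* On the right side, p2 is pushed up to the comultiplication of s, where
       left linearity is available, and removed again afterwards. *)
    transitivity (((p1 ∘ m ∘ (idm B ⊗ (i2 ∘ p2))) ⊗ (p2 ∘ m))
      ∘ (idm B ⊗ Ψ B B ⊗ idm B)
      ∘ ((Δ ∘ (m ∘ (i1 ⊗ i2) ∘ ((p1 ⊗ p2) ∘ Δ))) ⊗ (Δ ∘ i2))).
    { symmetry. drw FG. smc. }
    drw <- (p2_mul_i2_p2 hF). drw <- (braid_natl _ _ B _ (fact_hom_p2 hF)).
    drw (comul_p2_mul_i1 hF).
    drw (braid_natl _ _ B _ (fact_hom_p2 hF)). drw (p2_mul_i2_p2 hF).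
    drw assoc. drw (p1_mul_i1 hF). smc.
Qed.

Lemma gamma2_relation_iff_twists :
  gamma2_relation B (i1 ∘ p1) (i2 ∘ p2) <-> twists B p1 i2 p2.
Proof.
  split.
  - intros H; apply twists_of_sigma_relation; unfold sigma_relation.
    rewrite sigma_formula. unfold gamma2_relation, gamma, delta in H.
    transitivity ((p1 ⊗ p2) ∘ Δ ∘ (m ∘ ((i2 ∘ p2) ⊗ idm B)) ∘ (i2 ⊗ i2)).
    { symmetry. drw (fact_p2_i2 hF). smc. }
    (* On elements of B2 the map δ_(2,1,2) is the identity, for p1 i2 is
       the counit followed by the unit. *)
    drw H. drw GF. drw (comul_p2_i2 hF). drw (p1_i2 hF).
    drw (alg_mor_unit (fact_i1 hF)). drw (alg_unitr (bialg_algebra hB)).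
    drw (coalg_counitl (fact_coalgebra hF)). drw (fact_p2_i2 hF). smc.
  - intros H; unfold gamma2_relation, gamma, delta, twists in *. symmetry.
    transitivity (m ∘ (i1 ⊗ i2) ∘ (((p1 ∘ m ∘ (idm B ⊗ (i2 ∘ p2))) ⊗ (p2 ∘ m))
    ∘ (idm B ⊗ Ψ B B ⊗ idm B) ∘ (Δ ⊗ (Δ ∘ i2))) ∘ (m ⊗ idm B2) ∘
      ((i2 ∘ p2) ⊗ (i1 ∘ p1) ⊗ p2) ∘ (idm B ⊗ Δ)); [smc|].
    drw <- H. drw FG. drw assoc. drw FG. smc.
Qed.

Lemma delta_relation_iff_mul_comul_relation :
  delta_relation B (i1 ∘ p1) <-> mul_comul_relation B B1 m1 B2 i1 p1 i2 p2.
Proof.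
  rewrite delta_relation_iff_absorbs; split.
  - exact mul_comul_relation_of_absorbs.
  - exact absorbs_of_mul_comul_relation.
Qed.

Lemma phi_relation_of_delta_relation :
  delta_relation B (i1 ∘ p1) -> phi_relation B B1 B2 Δ2 i1 p1 i2 p2.
Proof.
  rewrite delta_relation_iff_absorbs; exact phi_relation_of_absorbs.
Qed.

Lemma gamma2_relation_iff_sigma_relation :
  gamma2_relation B (i1 ∘ p1) (i2 ∘ p2) <->
  sigma_relation B B1 B2 Δ2 i1 p1 i2 p2.
Proof.
  rewrite gamma2_relation_iff_twists; split.
  - exact sigma_relation_of_twists.
  - exact twists_of_sigma_relation.
Qed.

End Relations.

Section DualRelations.

Context {C : strict_braided_category} {B : bialgebra_data C}
  {hB : is_bialgebra B}.

(** Duality exchanges (δ1) with (δ2), and (γ1) with (γ2). *)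
Lemma dual_delta_relation (Π : Mor C) : Π ⦂ B ⟶ B ->
  delta_relation B Π <-> @delta_relation (dual C) (dual_bialgebra B) Π.
Proof.
  intros HΠ; unfold delta_relation, delta; simpl; split; intros H;
    (refine (eq_trans _ (eq_trans H _)); smc).
Qed.

Lemma dual_gamma1_relation (Π1 Π2 : Mor C) : Π1 ⦂ B ⟶ B -> Π2 ⦂ B ⟶ B ->
  (idm B ⊗ Π1) ∘ comul B =
    delta B Π1 Π2 Π1 ∘ gamma B Π1 ∘ (Π1 ⊗ Π2) ∘ comul B <->
  @gamma2_relation (dual C) (dual_bialgebra B) Π2 Π1.
Proof.
  intros H1 H2.
  assert (E : gamma B Π1 = (mul B ⊗ mul B) ∘ (idm B ⊗ Ψ B B ⊗ idm B)
      ∘ (idm B ⊗ idm B ⊗ Π1 ⊗ idm B) ∘ (comul B ⊗ comul B)).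
  { unfold gamma; symmetry. drw (braid_natr _ _ B _ H1). smc. }
  rewrite E; unfold gamma2_relation, gamma, delta; simpl; split; intros H;
    (refine (eq_trans _ (eq_trans H _)); smc).
Qed.

End DualRelations.

(** * Transport along an isomorphism *)

Lemma transport_algebra {C : strict_monoidal_category} (A X : Ob C) m η f g :
  mutually_inverse A X f g -> is_algebra A m η ->
  is_algebra X (f ∘ m ∘ (g ⊗ g)) (f ∘ η).
Proof.
  intros (Hf & Hg & Hgf & Hfg) H; split.
  - hom.
  - hom.
  - drw Hgf. symmetry. drw Hgf. drw <- (alg_assoc H). smc.
  - drw Hgf. drw (alg_unitl H). drw Hfg. smc.
  - drw Hgf. drw (alg_unitr H). drw Hfg. smc.
Qed.

Section TransportBialgebra.

Context {C : strict_braided_category} (B : bialgebra_data C)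
  (hB : is_bialgebra B) (X : Ob C) (f g : Mor C)
  (hfg : mutually_inverse B X f g).

Definition transported : bialgebra_data C :=
  BialgebraData X (f ∘ mul B ∘ (g ⊗ g)) (f ∘ eta B)
    ((f ⊗ f) ∘ comul B ∘ g) (eps B ∘ g).

Lemma transported_is_bialgebra : is_bialgebra transported.
Proof.
  destruct (hfg) as (Hf & Hg & Hgf & Hfg).
  split; cbn [mul eta comul eps carrier transported].
  - exact (transport_algebra hfg (bialg_algebra hB)).
  - assert (hfg' : @mutually_inverse (dual C) B X g f).
    { split; [now apply dual_hom|split; [now apply dual_hom|now split]]. }
    pose proof (transport_algebra hfg' (dual_coalgebra _ _ _ (bialg_coalgebra hB)))
      as [H1 H2 H3 H4 H5]; simpl in *.
    split.
    + hom.
    + hom.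
    + symmetry. refine (eq_trans _ (eq_trans H3 _)); smc.
    + refine (eq_trans _ (eq_trans H5 _)); smc.
    + refine (eq_trans _ (eq_trans H4 _)); smc.
  - drw Hgf. drw (bialg_comul_mul hB). symmetry.
    drw (braid_natl _ _ X _ Hf). drw (braid_natr _ _ B _ Hf).
    drw Hgf. drw Hgf. drw Hgf. drw Hgf. smc.
  - drw Hgf. drw (bialg_comul_eta hB). smc.
  - drw Hgf. drw (bialg_eps_mul hB). smc.
  - drw Hgf. exact (bialg_eps_eta hB).
Qed.

Lemma transported_iso : bialgebra_iso B transported f.
Proof.
  destruct (hfg) as (Hf & Hg & Hgf & Hfg).
  split; [now exists g|split]; split; cbn [mul eta comul eps carrier transported].
  - assumption.
  - symmetry. drw Hgf. drw Hgf. smc.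
  - reflexivity.
  - assumption.
  - drw Hgf. smc.
  - drw Hgf. smc.
Qed.

End TransportBialgebra.

Lemma transport_factorization {C : strict_braided_category}
    (B X : bialgebra_data C) f g (B1 : Ob C) m1 η1 (B2 : Ob C) Δ2 ε2 i1 p1 i2 p2 :
  is_bialgebra B -> is_bialgebra X ->
  bialgebra_iso B X f -> mutually_inverse B X f g ->
  factorization X B1 m1 η1 B2 Δ2 ε2 i1 p1 i2 p2 ->
  factorization B B1 m1 η1 B2 Δ2 ε2 (g ∘ i1) (p1 ∘ f) (g ∘ i2) (p2 ∘ f).
Proof.
  intros HB HX Hiso Hfg HF.
  pose proof Hiso as (_ & Hma & Hmc).
  pose proof Hfg as (Hf & Hg & Egf & Efg).
  assert (Eg : mul B ∘ (g ⊗ g) = g ∘ mul X).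
  { transitivity (g ∘ f ∘ (mul B ∘ (g ⊗ g))).
    - symmetry. drw Egf. smc.
    - drw (alg_mor_mul Hma). drw Efg. drw Efg. smc. }
  split.
  - exact _.
  - exact _.
  - split.
    + hom.
    + drw (alg_mor_mul (fact_i1 HF)). symmetry. drw Eg. smc.
    + drw (alg_mor_unit (fact_i1 HF)). rewrite <- (alg_mor_unit Hma).
      drw Egf. smc.
  - split.
    + hom.
    + drw (coalg_mor_comul (fact_p2 HF)). drw (coalg_mor_comul Hmc). smc.
    + drw (coalg_mor_counit (fact_p2 HF)). drw (coalg_mor_counit Hmc). smc.
  - hom.
  - hom.
  - drw Efg. drw (fact_p1_i1 HF). smc.
  - drw Efg. drw (fact_p2_i2 HF). smc.
  - drw <- (coalg_mor_comul Hmc). drw (alg_mor_mul Hma). drw Efg. drw Efg.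
    drw (fact_comul_mul HF). smc.
  - drw Eg. drw <- (coalg_mor_comul Hmc). drw (fact_mul_comul HF).
    drw Egf. smc.
Qed.

(** * Cross product algebras and coalgebras *)

Existing Class cross_product_algebra.
Existing Class cross_product_coalgebra.
#[export] Existing Instances cpa_algebra1 cpa_algebra cpc_coalgebra cpa_eta2_hom
  cpa_phi21_hom cpa_hsigma_hom cpc_coalgebra2
  cpc_eps1_hom cpc_phi12_hom cpc_hrho_hom.

Section CrossProductAlgebra.

Context {C : strict_monoidal_category} {B1 B2 : Ob C} {m1 η1 η2 φ21 hσ : Mor C}
  (hA : cross_product_algebra B1 B2 m1 η1 η2 φ21 hσ).

Let unitl1 := alg_unitl (cpa_algebra1 hA).
Let unitr1 := alg_unitr (cpa_algebra1 hA).
Let assoc1 := alg_assoc (cpa_algebra1 hA).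

Lemma cpa_unitl :
  (m1 ⊗ idm B2) ∘ (idm B1 ⊗ hσ) ∘ ((φ21 ∘ (η2 ⊗ idm B1)) ⊗ idm B2) =
  idm (B1 ⊠ B2).
Proof.
  rewrite <- (alg_unitl (cpa_algebra hA)); unfold cp_mul.
  symmetry. drw unitl1. smc.
Qed.

(** The left unit law composed with 1 ⊗ η2 contains the expression of φ21
    through the hatted σ. *)
Lemma phi21_unitl : φ21 ∘ (η2 ⊗ idm B1) = idm B1 ⊗ η2.
Proof.
  rewrite (cpa_phi21 hA).
  transitivity ((m1 ⊗ idm B2) ∘ (idm B1 ⊗ hσ)
    ∘ ((φ21 ∘ (η2 ⊗ idm B1)) ⊗ idm B2) ∘ (idm B1 ⊗ η2)); [smc|].
  rewrite cpa_unitl; smc.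
Qed.

Lemma hsigma_unitl : hσ ∘ (η2 ⊗ idm B2) = η1 ⊗ idm B2.
Proof.
  transitivity ((m1 ⊗ idm B2) ∘ (idm B1 ⊗ hσ)
    ∘ ((φ21 ∘ (η2 ⊗ idm B1)) ⊗ idm B2) ∘ (η1 ⊗ idm B2)).
  - rewrite phi21_unitl. symmetry. drw unitl1. smc.
  - rewrite cpa_unitl; smc.
Qed.

Lemma phi21_unitr : φ21 ∘ (idm B2 ⊗ η1) = η1 ⊗ idm B2.
Proof.
  transitivity (cp_mul B1 B2 m1 φ21 hσ ∘ (idm (B1 ⊠ B2) ⊗ (η1 ⊗ η2))
    ∘ (η1 ⊗ idm B2)).
  - unfold cp_mul. symmetry. drw assoc1.
    drw unitl1. drw <- (cpa_phi21 hA). smc.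
  - drw (alg_unitr (cpa_algebra hA)). smc.
Qed.

(** The cross product restricted to the inclusions i1 = 1 ⊗ η2 and
    i2 = η1 ⊗ 1: it determines m1, φ21 and the hatted σ. *)
Lemma cp_mul_i1_i1 :
  cp_mul B1 B2 m1 φ21 hσ ∘ ((idm B1 ⊗ η2) ⊗ (idm B1 ⊗ η2)) = m1 ⊗ η2.
Proof.
  unfold cp_mul. drw phi21_unitl. drw hsigma_unitl. drw unitr1. smc.
Qed.

Lemma cp_mul_i1_i2 :
  cp_mul B1 B2 m1 φ21 hσ ∘ ((idm B1 ⊗ η2) ⊗ (η1 ⊗ idm B2)) = idm (B1 ⊠ B2).
Proof.
  unfold cp_mul. drw phi21_unitl. drw hsigma_unitl. drw unitr1. drw unitr1. smc.
Qed.

Lemma cp_mul_i2_i1 :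
  cp_mul B1 B2 m1 φ21 hσ ∘ ((η1 ⊗ idm B2) ⊗ (idm B1 ⊗ η2)) = φ21.
Proof.
  unfold cp_mul. drw unitl1. rewrite (cpa_phi21 hA) at 2. smc.
Qed.

Lemma cp_mul_i2_i2 :
  cp_mul B1 B2 m1 φ21 hσ ∘ ((η1 ⊗ idm B2) ⊗ (η1 ⊗ idm B2)) = hσ.
Proof.
  unfold cp_mul. drw phi21_unitr. drw unitl1. drw unitl1. smc.
Qed.

End CrossProductAlgebra.

Lemma dual_cross_product_coalgebra {C : strict_braided_category} {B1 B2 : Ob C}
    {Δ2 ε2 ε1 φ12 hρ : Mor C} :
  cross_product_coalgebra B1 B2 Δ2 ε2 ε1 φ12 hρ ->
  @cross_product_algebra (dual C) B2 B1 Δ2 ε2 ε1 φ12 hρ.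
Proof.
  intros H; split.
  - now apply dual_coalgebra, H.
  - apply dual_hom, H.
  - apply dual_hom, H.
  - apply dual_hom, H.
  - refine (eq_trans (cpc_phi12 H) _). simpl. smc.
  - assert (E : cp_comul B1 B2 Δ2 φ12 hρ =
              @cp_mul (dual C) B2 B1 Δ2 φ12 hρ)
      by (unfold cp_mul, cp_comul; simpl; smc).
    rewrite <- E. exact (dual_coalgebra _ _ _ (cpc_coalgebra H)).
Qed.

Section CrossProductCoalgebra.

Context {C : strict_braided_category} {B1 B2 : Ob C} {Δ2 ε2 ε1 φ12 hρ : Mor C}
  (hA : cross_product_coalgebra B1 B2 Δ2 ε2 ε1 φ12 hρ).

Let hA' := dual_cross_product_coalgebra hA.

Lemma cp_comul_p2_p2 :
  ((ε1 ⊗ idm B2) ⊗ (ε1 ⊗ idm B2)) ∘ cp_comul B1 B2 Δ2 φ12 hρ = ε1 ⊗ Δ2.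
Proof.
  pose proof (cp_mul_i1_i1 hA') as H; unfold cp_mul in H.
  unfold cp_comul; by_dual H.
Qed.

Lemma cp_comul_p1_p2 :
  ((idm B1 ⊗ ε2) ⊗ (ε1 ⊗ idm B2)) ∘ cp_comul B1 B2 Δ2 φ12 hρ = idm (B1 ⊠ B2).
Proof.
  pose proof (cp_mul_i1_i2 hA') as H; unfold cp_mul in H.
  unfold cp_comul; by_dual H.
Qed.

Lemma cp_comul_p2_p1 :
  ((ε1 ⊗ idm B2) ⊗ (idm B1 ⊗ ε2)) ∘ cp_comul B1 B2 Δ2 φ12 hρ = φ12.
Proof.
  pose proof (cp_mul_i2_i1 hA') as H; unfold cp_mul in H.
  unfold cp_comul; by_dual H.
Qed.

Lemma cp_comul_p1_p1 :
  ((idm B1 ⊗ ε2) ⊗ (idm B1 ⊗ ε2)) ∘ cp_comul B1 B2 Δ2 φ12 hρ = hρ.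
Proof.
  pose proof (cp_mul_i2_i2 hA') as H; unfold cp_mul in H.
  unfold cp_comul; by_dual H.
Qed.

End CrossProductCoalgebra.

(** * From projections to a cocycle cross product *)

Section FactorizedProduct.

Context {C : strict_braided_category} {B : bialgebra_data C}
  {hB : is_bialgebra B} {B1 : Ob C} {m1 η1 : Mor C} {B2 : Ob C}
  {Δ2 ε2 i1 p1 i2 p2 : Mor C}
  (hF : factorization B B1 m1 η1 B2 Δ2 ε2 i1 p1 i2 p2).

Local Notation m := (mul B).
Local Notation Δ := (comul B).

Let FG := fact_mul_comul hF.
Let GF := fact_comul_mul hF.

(** Associativity turns (a x)(b y) into a (x b) y; factoring x b = b1 x1 and then
    x1 y gives the cross product formula. *)
Lemma cp_mul_of_factorization :
  cp_mul B1 B2 m1 ((p1 ⊗ p2) ∘ Δ ∘ (m ∘ (i2 ⊗ i1)))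
    ((p1 ⊗ p2) ∘ Δ ∘ (m ∘ (i2 ⊗ i2))) =
  (p1 ⊗ p2) ∘ Δ ∘ m ∘ ((m ∘ (i1 ⊗ i2)) ⊗ (m ∘ (i1 ⊗ i2))).
Proof.
  assert (FGl : m ∘ (i1 ⊗ (m ∘ (i2 ⊗ idm B))) ∘ (((p1 ⊗ p2) ∘ Δ) ⊗ idm B) = m).
  { drw <- (alg_assoc (bialg_algebra hB)). drw FG. smc. }
  unfold cp_mul.
  (* Factoring a product again does not change it. *)
  match goal with |- ?f = _ =>
    transitivity (((p1 ⊗ p2) ∘ Δ ∘ (m ∘ (i1 ⊗ i2))) ∘ f) end.
  - rewrite GF. smc.
  - drw (alg_mor_mul (fact_i1 hF)). drw (alg_mor_mul (fact_i1 hF)).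
    drw (alg_assoc (bialg_algebra hB)) at 1. drw FG.
    drw (alg_assoc (bialg_algebra hB)). drw FGl.
    drw (alg_assoc (bialg_algebra hB)).
    symmetry. drw (alg_assoc (bialg_algebra hB)). smc.
Qed.

End FactorizedProduct.

Definition cross_product_of {C : strict_braided_category} (B : bialgebra_data C)
    (B1 : Ob C) (m1 η1 : Mor C) (B2 : Ob C) (Δ2 ε2 i1 p1 i2 p2 : Mor C) :
    cross_product_data C :=
  CrossProductData B1 B2 m1 η1 (p2 ∘ eta B)
    ((p1 ⊗ p2) ∘ comul B ∘ (mul B ∘ (i2 ⊗ i1)))
    ((p1 ⊗ p2) ∘ comul B ∘ (mul B ∘ (i2 ⊗ i2)))
    Δ2 ε2 (eps B ∘ i1)
    ((p2 ⊗ p1) ∘ comul B ∘ (mul B ∘ (i1 ⊗ i2)))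
    ((p1 ⊗ p1) ∘ comul B ∘ (mul B ∘ (i1 ⊗ i2))).

(** The cocycle relations for the composites that restrict or project the
    structure of [B]. In a factorization they are equivalent to the projection
    relations. *)
Definition canonical_cocycle_relations {C : strict_braided_category}
    (B : bialgebra_data C) (B1 : Ob C) (m1 η1 : Mor C)
    (B2 : Ob C) (Δ2 ε2 i1 p1 i2 p2 : Mor C) : Prop :=
  let m := mul B in let Δ := comul B in
  cocycle_relations B1 B2 m1 η1 (p2 ∘ eta B)
    ((p1 ⊗ p2) ∘ Δ ∘ (m ∘ (i2 ⊗ i1))) ((p1 ⊗ p2) ∘ Δ ∘ (m ∘ (i2 ⊗ i2)))
    Δ2 ε2 (eps B ∘ i1)
    ((p2 ⊗ p1) ∘ Δ ∘ (m ∘ (i1 ⊗ i2))) ((p1 ⊗ p1) ∘ Δ ∘ (m ∘ (i1 ⊗ i2)))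
    ((p1 ⊗ p1) ∘ Δ ∘ i1) (p2 ∘ (m ∘ (i2 ⊗ i2)))
    (p1 ∘ (m ∘ (i2 ⊗ i1))) (p2 ∘ (m ∘ (i2 ⊗ i1)))
    ((p2 ⊗ p1) ∘ Δ ∘ i1) ((p2 ⊗ p1) ∘ Δ ∘ i2)
    (p1 ∘ (m ∘ (i2 ⊗ i2))) ((p1 ⊗ p1) ∘ Δ ∘ i2).

Section CrossProductOfFactorization.

Context {C : strict_braided_category} {B : bialgebra_data C}
  {hB : is_bialgebra B} {B1 : Ob C} {m1 η1 : Mor C} {B2 : Ob C}
  {Δ2 ε2 i1 p1 i2 p2 : Mor C}
  (hF : factorization B B1 m1 η1 B2 Δ2 ε2 i1 p1 i2 p2).

Local Notation m := (mul B).
Local Notation η := (eta B).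
Local Notation Δ := (comul B).

Let hB' := dual_is_bialgebra _ hB.
Let hF' := dual_factorization hB hF.
Let FG := fact_mul_comul hF.
Let GF := fact_comul_mul hF.

Lemma cp_comul_of_factorization :
  cp_comul B1 B2 Δ2 ((p2 ⊗ p1) ∘ Δ ∘ (m ∘ (i1 ⊗ i2)))
    ((p1 ⊗ p1) ∘ Δ ∘ (m ∘ (i1 ⊗ i2))) =
  (((p1 ⊗ p2) ∘ Δ) ⊗ ((p1 ⊗ p2) ∘ Δ)) ∘ Δ ∘ (m ∘ (i1 ⊗ i2)).
Proof.
  pose proof (cp_mul_of_factorization (hB := hB') hF') as H.
  unfold cp_mul in H; unfold cp_comul; by_dual H.
Qed.

Lemma cross_product_of_transported :
  cp_bialgebra_data (cross_product_of B B1 m1 η1 B2 Δ2 ε2 i1 p1 i2 p2) =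
  transported B (B1 ⊠ B2) ((p1 ⊗ p2) ∘ Δ) (m ∘ (i1 ⊗ i2)).
Proof.
  unfold cross_product_of, transported; simpl.
  rewrite cp_mul_of_factorization by exact hF.
  rewrite cp_comul_of_factorization.
  f_equal.
  - symmetry. drw (bialg_comul_eta hB). drw (p1_eta hF). smc.
  - symmetry. drw (bialg_eps_mul hB). drw (eps_i2 hF). smc.
Qed.

Lemma cross_product_of_algebra :
  cross_product_algebra B1 B2 m1 η1 (p2 ∘ η)
    ((p1 ⊗ p2) ∘ Δ ∘ (m ∘ (i2 ⊗ i1))) ((p1 ⊗ p2) ∘ Δ ∘ (m ∘ (i2 ⊗ i2))).
Proof.
  pose proof (transported_is_bialgebra hB (factorization_iso hF)) as HX.
  rewrite <- cross_product_of_transported in HX.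
  split.
  - exact _.
  - hom.
  - hom.
  - hom.
  - symmetry. drw (i2_p2_eta hF). drw (alg_unitr (bialg_algebra hB)).
    match goal with |- ?f = _ =>
      transitivity (((p1 ⊗ p2) ∘ Δ ∘ (m ∘ (i1 ⊗ i2))) ∘ f) end.
    + rewrite GF. smc.
    + drw (alg_mor_mul (fact_i1 hF)). drw (alg_assoc (bialg_algebra hB)).
      drw FG. drw FG. smc.
  - exact (bialg_algebra HX).
Qed.

End CrossProductOfFactorization.

Lemma undual_cross_product_algebra {C : strict_braided_category} {B1 B2 : Ob C}
    {Δ2 ε2 ε1 φ12 hρ : Mor C} :
  is_coalgebra B2 Δ2 ε2 ->
  is_coalgebra (B1 ⊠ B2) (cp_comul B1 B2 Δ2 φ12 hρ) (ε1 ⊗ ε2) ->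
  @cross_product_algebra (dual C) B2 B1 Δ2 ε2 ε1 φ12 hρ ->
  cross_product_coalgebra B1 B2 Δ2 ε2 ε1 φ12 hρ.
Proof.
  intros H2 HX [_ H3 H4 H5 H6 _].
  assert (E1 : ε1 ⦂ B1 ⟶ 𝟙) by now destruct H3.
  assert (E2 : φ12 ⦂ B1 ⊠ B2 ⟶ B2 ⊠ B1) by now destruct H4.
  assert (E3 : hρ ⦂ B1 ⊠ B2 ⟶ B1 ⊠ B1) by now destruct H5.
  split; try assumption.
  by_dual H6.
Qed.

Section CocycleRelations.

Context {C : strict_braided_category} {B : bialgebra_data C}
  {hB : is_bialgebra B} {B1 : Ob C} {m1 η1 : Mor C} {B2 : Ob C}
  {Δ2 ε2 i1 p1 i2 p2 : Mor C}
  (hF : factorization B B1 m1 η1 B2 Δ2 ε2 i1 p1 i2 p2).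

Local Notation Δ := (comul B).

Let hB' := dual_is_bialgebra _ hB.
Let hF' := dual_factorization hB hF.

Lemma cross_product_bialgebra_of_factorization :
  cross_product_bialgebra (cross_product_of B B1 m1 η1 B2 Δ2 ε2 i1 p1 i2 p2).
Proof.
  pose proof (transported_is_bialgebra hB (factorization_iso hF)) as HX.
  rewrite <- (cross_product_of_transported hF) in HX.
  split; [exact (cross_product_of_algebra hF)|split; [|exact HX]].
  apply undual_cross_product_algebra.
  - exact _.
  - exact (bialg_coalgebra HX).
  - exact (cross_product_of_algebra (hB := hB') hF').
Qed.

Let i1_eta := alg_mor_unit (fact_i1 hF).
Let eps_p2 := coalg_mor_counit (fact_p2 hF).
Let unitl := alg_unitl (bialg_algebra hB).
Let unitr := alg_unitr (bialg_algebra hB).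
Let counitl := coalg_counitl (bialg_coalgebra hB).
Let counitr := coalg_counitr (bialg_coalgebra hB).
Let p1_i1 := fact_p1_i1 hF.
Let p2_i2 := fact_p2_i2 hF.
Let comul_eta := bialg_comul_eta hB.
Let eps_mul := bialg_eps_mul hB.

Lemma cocycle_relations_of_projection_relations :
  projection_relations B (i1 ∘ p1) (i2 ∘ p2) ->
  canonical_cocycle_relations B B1 m1 η1 B2 Δ2 ε2 i1 p1 i2 p2.
Proof.
  intros [G1 G2 D1 D2].
  assert (HΠ1 : i1 ∘ p1 ⦂ B ⟶ B) by hom.
  assert (HΠ2 : i2 ∘ p2 ⦂ B ⟶ B) by hom.
  apply (dual_gamma1_relation HΠ1 HΠ2) in G1.
  apply (dual_delta_relation HΠ2) in D2.
  apply (gamma2_relation_iff_sigma_relation hF) in G2.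
  apply (gamma2_relation_iff_sigma_relation (hB := hB') hF') in G1.
  pose proof (phi_relation_of_delta_relation hF D1) as P1.
  pose proof (phi_relation_of_delta_relation (hB := hB') hF' D2) as P2.
  apply (delta_relation_iff_mul_comul_relation hF) in D1.
  apply (delta_relation_iff_mul_comul_relation (hB := hB') hF') in D2.
  unfold sigma_relation, phi_relation, mul_comul_relation in *.
  unfold canonical_cocycle_relations.
  split; try hom.
  - by_dual P2.
  - exact P1.
  - exact G2.
  - by_dual G1.
  - drw i1_eta. drw comul_eta. drw (p1_eta hF). drw (p1_eta hF). smc.
  - drw (eps_i1_p1 hF). drw counitr. drw p1_i1. smc.
  - drw (eps_i1_p1 hF). drw counitl. drw p1_i1. smc.
  - drw eps_p2. drw eps_mul. drw (eps_i2 hF). drw (eps_i2 hF). smc.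
  - drw (i2_p2_eta hF). drw unitr. drw p2_i2. smc.
  - drw (i2_p2_eta hF). drw unitl. drw p2_i2. smc.
  - drw (i2_p2_eta hF). drw unitl. drw p1_i1. smc.
  - drw i1_eta. drw unitr. drw (p1_i2 hF). smc.
  - drw (eps_i1_p1 hF). drw eps_mul. drw (eps_i2 hF). smc.
  - drw i1_eta. drw unitr. drw p2_i2. smc.
  - drw (i2_p2_eta hF). drw unitl. drw (p2_i1 hF). smc.
  - drw eps_p2. drw eps_mul. drw (eps_i2 hF). smc.
  - drw eps_p2. drw counitl. drw p1_i1. smc.
  - drw (eps_i1_p1 hF). drw counitr. drw (p2_i1 hF). smc.
  - drw i1_eta. drw comul_eta. drw (p1_eta hF). smc.
  - drw (eps_i1_p1 hF). drw counitr. drw p2_i2. smc.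
  - drw eps_p2. drw counitl. drw (p1_i2 hF). smc.
  - drw (i2_p2_eta hF). drw comul_eta. drw (p1_eta hF). smc.
  - by_dual D2.
  - exact D1.
Qed.

Lemma projection_relations_of_cocycle_relations :
  canonical_cocycle_relations B B1 m1 η1 B2 Δ2 ε2 i1 p1 i2 p2 ->
  projection_relations B (i1 ∘ p1) (i2 ∘ p2).
Proof.
  intros H.
  assert (HΠ1 : i1 ∘ p1 ⦂ B ⟶ B) by hom.
  assert (HΠ2 : i2 ∘ p2 ⦂ B ⟶ B) by hom.
  split.
  - apply (dual_gamma1_relation HΠ1 HΠ2).
    apply (gamma2_relation_iff_sigma_relation (hB := hB') hF').
    unfold sigma_relation; simpl.
    refine (eq_trans _ (eq_trans (ccp_hρ H) _)); smc.
  - apply (gamma2_relation_iff_sigma_relation hF). exact (ccp_hσ H).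
  - apply (delta_relation_iff_mul_comul_relation hF). exact (ccp_μl_Δ1 H).
  - apply (dual_delta_relation HΠ2).
    apply (delta_relation_iff_mul_comul_relation (hB := hB') hF').
    unfold mul_comul_relation; simpl.
    refine (eq_trans _ (eq_trans (ccp_m2_νr H) _)); smc.
Qed.

Lemma iso_to_cocycle_cross_product_of_factorization :
  projection_relations B (i1 ∘ p1) (i2 ∘ p2) -> iso_to_cocycle_cross_product B.
Proof.
  intros H.
  exists (cross_product_of B B1 m1 η1 B2 Δ2 ε2 i1 p1 i2 p2), ((p1 ⊗ p2) ∘ Δ).
  split; [split; [|split]|].
  - exact cross_product_bialgebra_of_factorization.
  - unfold normalized; simpl. drw i1_eta. exact (bialg_eps_eta hB).
  - do 8 eexists. exact (cocycle_relations_of_projection_relations H).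
  - rewrite (cross_product_of_transported hF).
    exact (transported_iso hB (factorization_iso hF)).
Qed.

End CocycleRelations.

(** * From a cocycle cross product to projections *)

Section FactorizationOfCrossProduct.

Context {C : strict_braided_category} {B1 B2 : Ob C}
  {m1 η1 η2 φ21 hσ Δ2 ε2 ε1 φ12 hρ : Mor C}
  (hA : cross_product_algebra B1 B2 m1 η1 η2 φ21 hσ)
  (hC : cross_product_coalgebra B1 B2 Δ2 ε2 ε1 φ12 hρ).

Let X : bialgebra_data C := cp_bialgebra_data
  (CrossProductData B1 B2 m1 η1 η2 φ21 hσ Δ2 ε2 ε1 φ12 hρ).

Context (hX : is_bialgebra X) (hn : ε1 ∘ η1 = idm 𝟙).

Lemma eps2_eta2 : ε2 ∘ η2 = idm 𝟙.
Proof.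
  pose proof (alg_unit_hom (cpa_algebra1 hA)) as [].
  pose proof (cpa_eta2_hom hA) as [].
  pose proof (cpc_eps1_hom hC) as [].
  pose proof (coalg_counit_hom (cpc_coalgebra2 hC)) as [].
  rewrite <- (bialg_eps_eta hX); simpl.
  now rewrite <- tens_comp, hn, tens_unitl by congruence.
Qed.

Lemma factorization_of_cross_product :
  factorization X B1 m1 η1 B2 Δ2 ε2
    (idm B1 ⊗ η2) (idm B1 ⊗ ε2) (η1 ⊗ idm B2) (ε1 ⊗ idm B2).
Proof.
  split; simpl.
  - exact _.
  - exact _.
  - split; simpl.
    + hom.
    + rewrite (cp_mul_i1_i1 hA). smc.
    + smc.
  - split; simpl.
    + hom.
    + rewrite (cp_comul_p2_p2 hC). smc.
    + smc.
  - hom.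
  - hom.
  - drw eps2_eta2. smc.
  - drw hn. smc.
  - rewrite (cp_mul_i1_i2 hA), (cp_comul_p1_p2 hC). smc.
  - rewrite (cp_mul_i1_i2 hA), (cp_comul_p1_p2 hC). smc.
Qed.

End FactorizationOfCrossProduct.

(** The components of φ21 and of the hatted σ are the structure morphisms of a
    cocycle cross product, which are therefore the composites read off from the
    projections. *)
Lemma phi21_components {C : strict_braided_category} (B1 B2 : Ob C)
    (Δ2 ε2 Δ1 ε1 μl μr φ21 : Mor C) :
  is_coalgebra B2 Δ2 ε2 -> Δ1 ⦂ B1 ⟶ B1 ⊠ B1 -> ε1 ⦂ B1 ⟶ 𝟙 ->
  μl ⦂ B2 ⊠ B1 ⟶ B1 -> μr ⦂ B2 ⊠ B1 ⟶ B2 ->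
  (idm B1 ⊗ ε1) ∘ Δ1 = idm B1 -> (ε1 ⊗ idm B1) ∘ Δ1 = idm B1 ->
  ε1 ∘ μl = ε2 ⊗ ε1 -> ε2 ∘ μr = ε2 ⊗ ε1 ->
  φ21 = (μl ⊗ μr) ∘ (idm B2 ⊗ Ψ B2 B1 ⊗ idm B1) ∘ (Δ2 ⊗ Δ1) ->
  (idm B1 ⊗ ε2) ∘ φ21 = μl /\ (ε1 ⊗ idm B2) ∘ φ21 = μr.
Proof.
  intros H2 HΔ1 Hε1 Hμl Hμr Hr Hl El Er ->.
  pose proof (coalg_counit_hom H2) as Hε2.
  split.
  - drw Er. drw (braid_forml _ B1 _ Hε2). drw (coalg_counitr H2). drw Hr. smc.
  - drw El. drw (braid_formr _ B2 _ Hε1). drw (coalg_counitl H2). drw Hl. smc.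
Qed.

Lemma hsigma_components {C : strict_braided_category} (B1 B2 : Ob C)
    (Δ2 ε2 η1 ε1 m2 μr νr σ hσ : Mor C) :
  is_coalgebra B2 Δ2 ε2 -> η1 ⦂ 𝟙 ⟶ B1 -> ε1 ⦂ B1 ⟶ 𝟙 ->
  m2 ⦂ B2 ⊠ B2 ⟶ B2 -> μr ⦂ B2 ⊠ B1 ⟶ B2 -> νr ⦂ B2 ⟶ B2 ⊠ B1 ->
  σ ⦂ B2 ⊠ B2 ⟶ B1 ->
  ε2 ∘ m2 = ε2 ⊗ ε2 -> ε2 ∘ μr = ε2 ⊗ ε1 -> μr ∘ (idm B2 ⊗ η1) = idm B2 ->
  (idm B2 ⊗ ε1) ∘ νr = idm B2 -> (ε2 ⊗ idm B1) ∘ νr = η1 ∘ ε2 ->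
  hσ = (σ ⊗ (m2 ∘ (μr ⊗ idm B2)))
    ∘ (idm B2 ⊗ Ψ B2 B2 ⊗ idm (B1 ⊠ B2))
    ∘ (Δ2 ⊗ ((νr ⊗ idm B2) ∘ Δ2)) ->
  (ε1 ⊗ ε2) ∘ hσ = ε2 ⊗ ε2 ->
  (idm B1 ⊗ ε2) ∘ hσ = σ /\ (ε1 ⊗ idm B2) ∘ hσ = m2.
Proof.
  intros H2 Hη1 Hε1 Hm2 Hμr Hνr Hσ Em Er Eη En1 En2 Ehσ.
  pose proof (coalg_counit_hom H2) as Hε2.
  assert (S : (idm B1 ⊗ ε2) ∘ hσ = σ).
  { rewrite Ehσ. drw Em. drw Er. drw (braid_forml _ B2 _ Hε2).
    drw (coalg_counitr H2). drw En1. drw (coalg_counitr H2). smc. }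
  intros E; split; [assumption|].
  (* σ is counital because the counit of the bialgebra is multiplicative. *)
  assert (Eσ : ε1 ∘ σ = ε2 ⊗ ε2).
  { rewrite <- E, <- S, Ehσ; smc. }
  rewrite Ehσ. drw Eσ. drw (braid_formr _ B2 _ Hε2). drw En2. drw Eη.
  drw (coalg_counitl H2). drw (coalg_counitl H2). smc.
Qed.

Section ProjectionsOfCocycle.

Context {C : strict_braided_category} {B1 B2 : Ob C}
  {m1 η1 η2 φ21 hσ Δ2 ε2 ε1 φ12 hρ : Mor C}
  {Δ1 m2 μl μr νl νr σ ρ : Mor C}
  (hA : cross_product_algebra B1 B2 m1 η1 η2 φ21 hσ)
  (hC : cross_product_coalgebra B1 B2 Δ2 ε2 ε1 φ12 hρ)
  (hR : cocycle_relations B1 B2 m1 η1 η2 φ21 hσ Δ2 ε2 ε1 φ12 hρ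
          Δ1 m2 μl μr νl νr σ ρ).

Let X : bialgebra_data C := cp_bialgebra_data
  (CrossProductData B1 B2 m1 η1 η2 φ21 hσ Δ2 ε2 ε1 φ12 hρ).

Context (hX : is_bialgebra X) (hn : ε1 ∘ η1 = idm 𝟙).

Lemma canonical_phi21 : (idm B1 ⊗ ε2) ∘ φ21 = μl /\ (ε1 ⊗ idm B2) ∘ φ21 = μr.
Proof.
  destruct hR; eapply phi21_components; try eassumption; exact _.
Qed.

Lemma canonical_hsigma : (idm B1 ⊗ ε2) ∘ hσ = σ /\ (ε1 ⊗ idm B2) ∘ hσ = m2.
Proof.
  destruct hR; eapply hsigma_components; try eassumption; try exact _.
  pose proof (bialg_eps_mul hX) as H; simpl in H.
  rewrite <- (cp_mul_i2_i2 hA) at 1. drw H. drw hn. drw hn. smc.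
Qed.

Lemma canonical_phi12 : φ12 ∘ (η1 ⊗ idm B2) = νr /\ φ12 ∘ (idm B1 ⊗ η2) = νl.
Proof.
  destruct hR.
  apply (@phi21_components (dual C) B2 B1 m1 η1 m2 η2 νr νl φ12);
    simpl; try assumption; try apply dual_hom; try exact _; try assumption.
  - apply dual_algebra; exact _.
  - refine (eq_trans ccp_φ12 _); smc.
Qed.

Lemma canonical_hrho : hρ ∘ (η1 ⊗ idm B2) = ρ /\ hρ ∘ (idm B1 ⊗ η2) = Δ1.
Proof.
  destruct hR.
  apply (@hsigma_components (dual C) B2 B1 m1 η1 ε2 η2 Δ1 νl μl ρ hρ);
    simpl; try assumption; try apply dual_hom; try exact _; try assumption.
  - apply dual_algebra; exact _.
  - refine (eq_trans ccp_hρ _); smc.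
  - rewrite <- (cp_comul_p1_p1 hC) at 1.
    pose proof (bialg_comul_eta hX) as H; simpl in H.
    pose proof (eps2_eta2 hA hC hX hn) as En.
    drw H. drw En. drw En. smc.
Qed.

Lemma canonical_cocycle_relations_of_cross_product :
  canonical_cocycle_relations X B1 m1 η1 B2 Δ2 ε2
    (idm B1 ⊗ η2) (idm B1 ⊗ ε2) (η1 ⊗ idm B2) (ε1 ⊗ idm B2).
Proof.
  destruct canonical_phi21 as [Eμl Eμr], canonical_hsigma as [Eσ Em2],
    canonical_phi12 as [Eνr Eνl], canonical_hrho as [Eρ EΔ1].
  pose proof (eps2_eta2 hA hC hX hn) as En.
  pose proof (cp_mul_i2_i1 hA) as M21; pose proof (cp_mul_i2_i2 hA) as M22.
  pose proof (cp_comul_p2_p1 hC) as D21; pose proof (cp_comul_p1_p1 hC) as D11.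
  pose proof (cp_mul_i1_i2 hA) as M12; pose proof (cp_comul_p1_p2 hC) as D12.
  unfold canonical_cocycle_relations; simpl.
  rewrite !M12, !D12, !D21, !D11, Eνr, Eνl, Eρ, EΔ1.
  rewrite !M21, !M22, Eμl, Eμr, Eσ, Em2.
  replace ((ε1 ⊗ idm B2) ∘ (η1 ⊗ η2)) with η2 by (symmetry; drw hn; smc).
  replace ((ε1 ⊗ ε2) ∘ (idm B1 ⊗ η2)) with ε1 by (symmetry; drw En; smc).
  replace (idm (B1 ⊠ B2) ∘ φ21) with φ21 by smc.
  replace (idm (B1 ⊠ B2) ∘ hσ) with hσ by smc.
  replace (φ12 ∘ idm (B1 ⊠ B2)) with φ12 by smc.
  replace (hρ ∘ idm (B1 ⊠ B2)) with hρ by smc.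
  exact hR.
Qed.

End ProjectionsOfCocycle.

Lemma transport_canonical_cocycle_relations {C : strict_braided_category}
    (B X : bialgebra_data C) f g (B1 : Ob C) m1 η1 (B2 : Ob C) Δ2 ε2 i1 p1 i2 p2 :
  is_bialgebra B -> is_bialgebra X ->
  bialgebra_iso B X f -> mutually_inverse B X f g ->
  factorization X B1 m1 η1 B2 Δ2 ε2 i1 p1 i2 p2 ->
  canonical_cocycle_relations X B1 m1 η1 B2 Δ2 ε2 i1 p1 i2 p2 ->
  canonical_cocycle_relations B B1 m1 η1 B2 Δ2 ε2
    (g ∘ i1) (p1 ∘ f) (g ∘ i2) (p2 ∘ f).
Proof.
  intros HB HX Hiso Hfg HF HR.
  pose proof Hiso as (_ & Hma & Hmc).
  pose proof Hfg as (Hf & Hg & Egf & Efg).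
  assert (M : forall (Y Y' Z : Ob C) a b q,
    a ⦂ Y ⟶ X -> b ⦂ Y' ⟶ X -> q ⦂ X ⟶ Z ->
    q ∘ f ∘ (mul B ∘ ((g ∘ a) ⊗ (g ∘ b))) = q ∘ (mul X ∘ (a ⊗ b))).
  { intros * Ha Hb Hq. drw (alg_mor_mul Hma). drw Efg. drw Efg. smc. }
  assert (D : forall (Y Y' Z : Ob C) a q r,
    a ⦂ Z ⟶ X -> q ⦂ X ⟶ Y -> r ⦂ X ⟶ Y' ->
    ((q ∘ f) ⊗ (r ∘ f)) ∘ comul B ∘ (g ∘ a) = (q ⊗ r) ∘ comul X ∘ a).
  { intros * Ha Hq Hr. drw <- (coalg_mor_comul Hmc). drw Efg. smc. }
  assert (MD : forall (Y Y' Z Z' : Ob C) a b q r,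
    a ⦂ Z ⟶ X -> b ⦂ Z' ⟶ X -> q ⦂ X ⟶ Y -> r ⦂ X ⟶ Y' ->
    ((q ∘ f) ⊗ (r ∘ f)) ∘ comul B ∘ (mul B ∘ ((g ∘ a) ⊗ (g ∘ b))) =
    (q ⊗ r) ∘ comul X ∘ (mul X ∘ (a ⊗ b))).
  { intros * Ha Hb Hq Hr. drw <- (coalg_mor_comul Hmc).
    drw (alg_mor_mul Hma). drw Efg. drw Efg. smc. }
  pose proof (fact_hom_i1 HF) as I1; pose proof (fact_i2_hom HF) as I2.
  pose proof (fact_p1_hom HF) as P1; pose proof (fact_hom_p2 HF) as P2.
  unfold canonical_cocycle_relations in *; simpl in *.
  rewrite (MD _ _ _ _ _ _ _ _ I2 I1 P1 P2), (MD _ _ _ _ _ _ _ _ I2 I2 P1 P2),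
    (MD _ _ _ _ _ _ _ _ I1 I2 P2 P1), (MD _ _ _ _ _ _ _ _ I1 I2 P1 P1),
    (M _ _ _ _ _ _ I2 I1 P1), (M _ _ _ _ _ _ I2 I1 P2),
    (M _ _ _ _ _ _ I2 I2 P1), (M _ _ _ _ _ _ I2 I2 P2),
    (D _ _ _ _ _ _ I1 P1 P1), (D _ _ _ _ _ _ I2 P1 P1),
    (D _ _ _ _ _ _ I1 P2 P1), (D _ _ _ _ _ _ I2 P2 P1).
  replace (p2 ∘ f ∘ eta B) with (p2 ∘ eta X)
    by (rewrite <- (alg_mor_unit Hma); smc).
  replace (eps B ∘ (g ∘ i1)) with (eps X ∘ i1)
    by (rewrite <- (coalg_mor_counit Hmc); symmetry; drw Efg; smc).
  exact HR.
Qed.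

Lemma has_projection_factors_iff {C : strict_braided_category}
    (B : bialgebra_data C) :
  is_bialgebra B ->
  has_projection_factors B <->
  exists (B1 : Ob C) m1 η1 (B2 : Ob C) Δ2 ε2 i1 p1 i2 p2,
    factorization B B1 m1 η1 B2 Δ2 ε2 i1 p1 i2 p2 /\
    projection_relations B (i1 ∘ p1) (i2 ∘ p2).
Proof.
  intros HB; split.
  - intros (B1 & m1 & η1 & B2 & Δ2 & ε2 & i1 & p1 & i2 & p2 & H1 & H2 & H3 & H4
      & H5 & H6 & H7 & H8 & H9 & H10 & (_ & _ & H11 & H12) & H13).
    exists B1, m1, η1, B2, Δ2, ε2, i1, p1, i2, p2.
    split; [split; assumption|assumption].
  - intros (B1 & m1 & η1 & B2 & Δ2 & ε2 & i1 & p1 & i2 & p2 & HF & HR).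
    pose proof (fact_hom_i1 HF); pose proof (fact_hom_p2 HF).
    exists B1, m1, η1, B2, Δ2, ε2, i1, p1, i2, p2.
    destruct HF.
    do 10 (split; [assumption|]); split; [|assumption].
    split; [hom|split; [hom|now split]].
Qed.

Lemma has_projection_factors_of_cocycle {C : strict_braided_category}
  (B : bialgebra_data C) (hB : is_bialgebra B) :
  iso_to_cocycle_cross_product B -> has_projection_factors B.
Proof.
  intros ([B1 B2 m1 η1 η2 φ21 hσ Δ2 ε2 ε1 φ12 hρ] & f & (HX & hn & HR) & Hf).
  destruct HX as (hA & hC & hX).
  destruct HR as (Δ1 & m2 & μl & μr & νl & νr & σ & ρ & hR).
  pose proof Hf as ((g & Hfg) & _).
  pose proof (factorization_of_cross_product hA hC hX hn) as hF.
  pose proof (canonical_cocycle_relations_of_cross_product hA hC hR hX hn) as hK.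
  pose proof (transport_factorization hB hX Hf Hfg hF) as hFB.
  pose proof (transport_canonical_cocycle_relations hB hX Hf Hfg hF hK) as hKB.
  apply has_projection_factors_iff; [assumption|].
  do 10 eexists; split; [exact hFB|].
  exact (projection_relations_of_cocycle_relations hFB hKB).
Qed.

(** * Splitting the idempotents *)

(** As i p fixes the products of elements of the image, projecting them changes
    nothing and associativity is inherited. In the dual category this constructs
    a quotient coalgebra. *)
Lemma split_algebra {C : strict_monoidal_category} (A A1 : Ob C) m η p i Π :
  is_algebra A m η -> is_splitting A A1 p i Π ->
  m ∘ (Π ⊗ Π) = Π ∘ m ∘ (Π ⊗ Π) -> Π ∘ η = η ->
  is_algebra A1 (p ∘ m ∘ (i ⊗ i)) (p ∘ η) /\
  algebra_morphism A1 (p ∘ m ∘ (i ⊗ i)) (p ∘ η) A m η i.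
Proof.
  intros HA (Hp & Hi & Epi & Eip) Em Eη; subst Π.
  assert (Emi : i ∘ p ∘ m ∘ (i ⊗ i) = m ∘ (i ⊗ i)).
  { transitivity (i ∘ p ∘ m ∘ ((i ∘ p) ⊗ (i ∘ p)) ∘ (i ⊗ i)).
    - symmetry. drw Epi. drw Epi. smc.
    - drw <- Em. drw Epi. drw Epi. smc. }
  split; split.
  - hom.
  - hom.
  - drw Emi. symmetry. drw Emi. drw <- (alg_assoc HA). smc.
  - drw Eη. drw (alg_unitl HA). drw Epi. smc.
  - drw Eη. drw (alg_unitr HA). drw Epi. smc.
  - assumption.
  - drw Emi. smc.
  - drw Eη. smc.
Qed.

Lemma has_projection_factors_of_idempotents {C : strict_braided_category}
    (hC : idempotents_split C) (B : bialgebra_data C) (hB : is_bialgebra B) :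
  has_projection_idempotents B -> has_projection_factors B.
Proof.
  intros (Π1 & Π2 & H1 & H2 & Em & Eη & EΔ & Eε & (_ & _ & FG & GF) & HR).
  destruct (hC _ _ H1) as (B1 & p1 & i1 & S1).
  destruct (hC _ _ H2) as (B2 & p2 & i2 & S2).
  destruct (split_algebra (bialg_algebra hB) S1 Em Eη) as [A1 M1].
  pose proof S1 as (Hp1 & Hi1 & E1 & E1'); pose proof S2 as (Hp2 & Hi2 & E2 & E2').
  assert (S2' : @is_splitting (dual C) B B2 i2 p2 Π2).
  { split; [now apply dual_hom|split; [now apply dual_hom|now split]]. }
  assert (HΠ2 : Π2 ⦂ B ⟶ B) by apply H2.
  assert (EΔ' : @comp (dual C) (comul B) (@tens (dual C) Π2 Π2) =
    @comp (dual C) (@comp (dual C) Π2 (comul B)) (@tens (dual C) Π2 Π2)).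
  { simpl. refine (eq_trans EΔ _). smc. }
  destruct (split_algebra (dual_coalgebra _ _ _ (bialg_coalgebra hB)) S2' EΔ' Eε)
    as [A2 M2]; simpl in A2, M2.
  subst Π1 Π2.
  apply has_projection_factors_iff; [assumption|].
  exists B1, (p1 ∘ mul B ∘ (i1 ⊗ i1)), (p1 ∘ eta B),
    B2, ((p2 ⊗ p2) ∘ (comul B ∘ i2)), (eps B ∘ i2), i1, p1, i2, p2.
  split; [|assumption].
  split; try assumption.
  - destruct A2; split; try hom; try assumption; now symmetry.
  - destruct M2; split; assumption.
  - symmetry.
    transitivity ((p1 ⊗ p2) ∘ ((i1 ∘ p1) ⊗ (i2 ∘ p2)) ∘ (i1 ⊗ i2)).
    + symmetry. drw E1. drw E1. drw E2. drw E2. smc.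
    + rewrite <- GF. drw E1. drw E1. drw E2. drw E2. smc.
  - rewrite <- FG. symmetry. drw E1. drw E2. smc.
Qed.

Lemma has_projection_idempotents_of_factors {C : strict_braided_category}
    (B : bialgebra_data C) (hB : is_bialgebra B) :
  has_projection_factors B -> has_projection_idempotents B.
Proof.
  intros H; apply has_projection_factors_iff in H; [|assumption].
  destruct H as (B1 & m1 & η1 & B2 & Δ2 & ε2 & i1 & p1 & i2 & p2 & HF & HR).
  pose proof (fact_p1_i1 HF) as E1; pose proof (fact_p2_i2 HF) as E2.
  exists (i1 ∘ p1), (i2 ∘ p2).
  split; [split; [hom | drw E1; smc]|].
  split; [split; [hom | drw E2; smc]|].
  split.
  { drw <- (alg_mor_mul (fact_i1 HF)). symmetry.
    drw <- (alg_mor_mul (fact_i1 HF)). drw E1. smc. }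
  split.
  { drw (p1_eta HF). drw (alg_mor_unit (fact_i1 HF)). smc. }
  split.
  { drw <- (coalg_mor_comul (fact_p2 HF)). symmetry.
    drw <- (coalg_mor_comul (fact_p2 HF)). drw E2. smc. }
  split.
  { drw (eps_i2 HF). drw (coalg_mor_counit (fact_p2 HF)). smc. }
  split; [|assumption].
  split; [hom|split; [hom|split]].
  - rewrite <- (fact_mul_comul HF). drw E1. drw E2. smc.
  - transitivity ((i1 ⊗ i2) ∘ ((p1 ⊗ p2) ∘ comul B ∘ (mul B ∘ (i1 ⊗ i2)))
      ∘ (p1 ⊗ p2)); [smc|].
    rewrite (fact_comul_mul HF). smc.
Qed.

Unset Implicit Arguments.
Set Strict Implicit.

Theorem theorem3p6 (C : strict_braided_category) (hC : idempotents_split C)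
    (B : bialgebra_data C) (hB : is_bialgebra B) :
  (iso_to_cocycle_cross_product B <-> has_projection_idempotents B) /\
  (has_projection_idempotents B <-> has_projection_factors B).
Proof.
  assert (H13 := has_projection_factors_of_cocycle hB).
  assert (H23 := has_projection_factors_of_idempotents hC hB).
  assert (H32 := has_projection_idempotents_of_factors hB).
  assert (H31 : has_projection_factors B -> iso_to_cocycle_cross_product B).
  { intros H; apply has_projection_factors_iff in H; [|assumption].
    destruct H as (B1 & m1 & η1 & B2 & Δ2 & ε2 & i1 & p1 & i2 & p2 & HF & HR).
    exact (iso_to_cocycle_cross_product_of_factorization HF HR). }
  tauto.
Qed.
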